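(* Let $\mathcal{A}$ be a semisimple Hopf algebra over a field. The maps $$\mathcal{N}\mapsto P_{\mathcal{N}}:=\text{the central projection of }\mathcal{N}\text{ satisfying }\ker(\varepsilon|_{\mathcal{N}})=(1-P_{\mathcal{N}})\mathcal{N}$$ and $P\mapsto\mathcal{N}_P$ are mutually inverse bijections between the set of left coideal subalgebras of $\mathcal{A}$ and the set of right group-like projections of $\mathcal{A}$.
   Context: $(\mathcal{A},\Delta,S,\varepsilon)$ is a Hopf algebra over an arbitrary field with invertible antipode $S$ and unit $1$. A left coideal subalgebra is a unital subalgebra $\mathcal{N}\subset\mathcal{A}$ with $\Delta(\mathcal{N})\subset\mathcal{A}\otimes\mathcal{N}$. A projection is an idempotent; a central projection of $\mathcal{N}$ is an idempotent of $\mathcal{N}$ commuting with all elements of $\mathcal{N}$. A right group-like projection is a non-zero projection $P\in\mathcal{A}$ with $\Delta(P)(1\otimes P)=P\otimes P=(1\otimes P)\Delta(P)$. $\mathcal{N}_P=\{x\in\mathcal{A}:\Delta(x)(1\otimes P)=(1\otimes P)\Delta(x)=x\otimes P\}$. When $\mathcal{A}$ is semisimple, so is every left coideal subalgebra $\mathcal{N}$, and hence $P_{\mathcal{N}}$ exists and is unique. *)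

(* Defs.v *)
From HB Require Import structures.
From mathcomp Require Import all_boot all_order all_algebra.
From mathcomp Require Import boolp classical_sets functions.

Set Implicit Arguments.
Unset Strict Implicit.
Unset Printing Implicit Defensive.

Import GRing.Theory.
Local Open Scope quotient_scope.
Local Open Scope ring_scope.

(* The tensor product of two vector spaces: finite formal sums of pairs        *)
(* (sequences), two of them being identified when every bilinear map takes the *)
(* same value on them.                                                         *)

Section Tensor.
Variables (K : fieldType) (U V : lmodType K).

Definition tsum (W : lmodType K) (f : U -> V -> W) (s : seq (U * V)) : W :=
  \sum_(p <- s) f p.1 p.2.

Definition tequiv : rel (seq (U * V)) := fun s t =>
  `[< forall (W : lmodType K) (f : U -> V -> W),
        bilinear_for *:%R *:%R f -> tsum f s = tsum f t >].

Lemma tequiv_refl : reflexive tequiv.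
Proof. by move=> s; apply/asboolP. Qed.

Lemma tequiv_sym : symmetric tequiv.
Proof.
by move=> s t; apply/asboolP/asboolP => h W f fb; rewrite (h W f fb).
Qed.

Lemma tequiv_trans : transitive tequiv.
Proof.
move=> t s u /asboolP st /asboolP tu; apply/asboolP => W f fb.
by rewrite (st W f fb) (tu W f fb).
Qed.

Canonical tequiv_equiv := EquivRel tequiv tequiv_refl tequiv_sym tequiv_trans.

Definition tensor : Type := {eq_quot tequiv}.

HB.instance Definition _ : EqQuotient _ tequiv tensor := EqQuotient.on tensor.
HB.instance Definition _ := Choice.on tensor.

(* The linear map induced by f; it is meaningful when f is bilinear. *)
Definition tlift (W : lmodType K) (f : U -> V -> W) (x : tensor) : W :=
  tsum f (repr x).

Definition tpure (u : U) (v : V) : tensor := \pi_tensor [:: (u, v)].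

Definition tzero : tensor := \pi_tensor [::].
Definition tadd (x y : tensor) : tensor := 
  \pi_tensor ((repr x : seq (U * V)) ++ (repr y : seq (U * V))).
Definition tscale (a : K) (x : tensor) : tensor :=
  \pi_tensor [seq (a *: p.1, p.2) | p <- (repr x : seq (U * V))].

Section Lift.
Variables (W : lmodType K) (f : U -> V -> W).
Hypothesis fb : bilinear_for *:%R *:%R f.

Lemma bilinZl a u v : f (a *: u) v = a *: f u v.
Proof. by rewrite (scalable_linear (fb.1 v)). Qed.

Lemma bilinBl u u' v : f (u - u') v = f u v - f u' v.
Proof. exact: (zmod_morphism_linear (fb.1 v)). Qed.

Lemma tlift_pi s : tlift f (\pi_tensor s) = tsum f s.
Proof.
have /eqP/eqquotP/asboolP h : \pi_tensor (repr (\pi_tensor s)) == \pi_tensor s.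
  by rewrite reprK.
exact: h W f fb.
Qed.

Lemma tlift_pure u v : tlift f (tpure u v) = f u v.
Proof. by rewrite tlift_pi /tsum big_seq1. Qed.

Lemma tlift_tzero : tlift f tzero = 0.
Proof. by rewrite tlift_pi /tsum big_nil. Qed.

Lemma tlift_tadd x y : tlift f (tadd x y) = tlift f x + tlift f y.
Proof. by rewrite tlift_pi /tsum big_cat. Qed.

Lemma tlift_tscale a x : tlift f (tscale a x) = a *: tlift f x.
Proof.
rewrite tlift_pi /tlift /tsum big_map scaler_sumr.
by apply: eq_bigr => p _; rewrite bilinZl.
Qed.

End Lift.

Lemma tensor_eq (x y : tensor) :
  (forall (W : lmodType K) (f : U -> V -> W),
     bilinear_for *:%R *:%R f -> tlift f x = tlift f y) -> x = y.
Proof.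
by move=> h; rewrite -[x]reprK -[y]reprK; apply/eqquotP/asboolP => W f; apply: h.
Qed.

Fact taddA : associative tadd.
Proof.
by move=> x y z; apply: tensor_eq => W f fb; rewrite !tlift_tadd // addrA.
Qed.

Fact taddC : commutative tadd.
Proof.
by move=> x y; apply: tensor_eq => W f fb; rewrite !tlift_tadd // addrC.
Qed.

Fact tadd0 : left_id tzero tadd.
Proof.
move=> x; apply: tensor_eq => W f fb.
by rewrite tlift_tadd // tlift_tzero // add0r.
Qed.

Fact taddN : left_inverse tzero (tscale (-1)) tadd.
Proof.
move=> x; apply: tensor_eq => W f fb.
by rewrite tlift_tadd // tlift_tscale // tlift_tzero // scaleN1r addNr.
Qed.

HB.instance Definition _ := GRing.isZmodule.Build tensor taddA taddC tadd0 taddN.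

Fact tscaleA a b x : tscale a (tscale b x) = tscale (a * b) x.
Proof.
by apply: tensor_eq => W f fb; rewrite !tlift_tscale // scalerA.
Qed.

Fact tscale1 : left_id 1 tscale.
Proof.
by move=> x; apply: tensor_eq => W f fb; rewrite tlift_tscale // scale1r.
Qed.

Fact tscaleDr : right_distributive tscale +%R.
Proof.
move=> a x y; apply: tensor_eq => W f fb.
by rewrite !(tlift_tadd, tlift_tscale) // scalerDr.
Qed.

Fact tscaleDl x : {morph tscale^~ x : a b / a + b}.
Proof.
move=> a b; apply: tensor_eq => W f fb.
by rewrite !(tlift_tadd, tlift_tscale) // scalerDl.
Qed.

HB.instance Definition _ := GRing.Zmodule_isLmodule.Build K tensor
  tscaleA tscale1 tscaleDr tscaleDl.

Lemma tlift_linear (W : lmodType K) (f : U -> V -> W) :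
  bilinear_for *:%R *:%R f -> linear (tlift f).
Proof. by move=> fb a x y; rewrite tlift_tadd // tlift_tscale. Qed.

Lemma tpure_bilinear : bilinear_for *:%R *:%R tpure.
Proof.
split=> [v a u u'|u a v v']; apply: tensor_eq => W f fb.
  by rewrite tlift_linear // !tlift_pure // (fb.1 v).
by rewrite tlift_linear // !tlift_pure // (fb.2 u).
Qed.

Lemma tensor_sumE (x : tensor) : x = \sum_(p <- repr x) tpure p.1 p.2.
Proof.
apply: tensor_eq => W f fb.
have lsum s : tlift f (\sum_(p <- s) tpure p.1 p.2) = tsum f s.
  elim: s => [|p s IHs]; first by rewrite /tsum !big_nil tlift_tzero.
  by rewrite /tsum !big_cons tlift_tadd // IHs tlift_pure.
by rewrite lsum.
Qed.

Lemma tensor_ind (P : tensor -> Prop) :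
    P 0 -> (forall u v, P (tpure u v)) ->
    (forall x y, P x -> P y -> P (x + y)) ->
  forall x, P x.
Proof.
by move=> P0 Pp PD x; rewrite (tensor_sumE x); apply: big_ind.
Qed.

End Tensor.

Notation "u ⊗ v" := (tpure u v) (at level 40, left associativity) : ring_scope.

Definition tmap (K : fieldType) (U V U' V' : lmodType K)
    (f : U -> U') (g : V -> V') : tensor U V -> tensor U' V' :=
  tlift (fun u v => f u ⊗ g v).

Definition tassoc (K : fieldType) (U V W : lmodType K) :
    tensor (tensor U V) W -> tensor U (tensor V W) :=
  tlift (fun x w => tlift (fun u v => u ⊗ (v ⊗ w)) x).

Section TensorAlgebra.
Variables (K : fieldType) (A B : algType K).
Implicit Types x y z : tensor A B.

Definition tone : tensor A B := 1 ⊗ 1.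

Definition tmul x y : tensor A B :=
  tlift (fun a b => tlift (fun a' b' => (a * a') ⊗ (b * b')) y) x.

Lemma tmul_bilin_in (a : A) (b : B) :
  bilinear_for *:%R *:%R (fun a' b' => (a * a') ⊗ (b * b')).
Proof.
split=> [v c u u'|u c v v'] /=; rewrite mulrDr -scalerAr.
  exact: (tpure_bilinear A B).1.
exact: (tpure_bilinear A B).2.
Qed.

Lemma tmul_bilin_out y : bilinear_for *:%R *:%R
  (fun (a : A) (b : B) => tlift (fun a' b' => (a * a') ⊗ (b * b')) y).
Proof.
split=> [v c u u'|u c v v'] /=; rewrite /tlift /tsum scaler_sumr -big_split;
  apply: eq_bigr => p _ /=; rewrite mulrDl -scalerAl.
  exact: (tpure_bilinear A B).1.
exact: (tpure_bilinear A B).2.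
Qed.

Lemma tmul_pure (a a' : A) (b b' : B) :
  tmul (a ⊗ b) (a' ⊗ b') = (a * a') ⊗ (b * b').
Proof.
by rewrite /tmul (tlift_pure (tmul_bilin_out _)) (tlift_pure (tmul_bilin_in _ _)).
Qed.

Fact tmulDl : left_distributive tmul +%R.
Proof. by move=> x y z; apply: (tlift_tadd (tmul_bilin_out z)). Qed.

Fact tmulDr : right_distributive tmul +%R.
Proof.
move=> x y z; rewrite /tmul /tlift /tsum -big_split; apply: eq_bigr => p _ /=.
exact: (tlift_tadd (tmul_bilin_in _ _)).
Qed.

Fact tmul0l x : tmul 0 x = 0.
Proof. by apply: (addIr (tmul 0 x)); rewrite -tmulDl !add0r. Qed.

Fact tmul0r x : tmul x 0 = 0.
Proof. by apply: (addIr (tmul x 0)); rewrite -tmulDr !add0r. Qed.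

Fact tmul1l : left_id tone tmul.
Proof.
elim/tensor_ind => [|a b|x y IHx IHy]; first exact: tmul0r.
  by rewrite tmul_pure !mul1r.
by rewrite tmulDr IHx IHy.
Qed.

Fact tmul1r : right_id tone tmul.
Proof.
elim/tensor_ind => [|a b|x y IHx IHy]; first exact: tmul0l.
  by rewrite tmul_pure !mulr1.
by rewrite tmulDl IHx IHy.
Qed.

Fact tmulA : associative tmul.
Proof.
elim/tensor_ind => [|a b|x x' IHx IHx'] y z; first by rewrite !tmul0l.
  elim/tensor_ind: y => [|a' b'|y y' IHy IHy']; first by rewrite !(tmul0l, tmul0r).
    elim/tensor_ind: z => [|a'' b''|z z' IHz IHz']; first by rewrite !tmul0r.
      by rewrite !tmul_pure !mulrA.
    by rewrite !tmulDr IHz IHz'.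
  by rewrite !(tmulDl, tmulDr) IHy IHy'.
by rewrite !tmulDl IHx IHx'.
Qed.

HB.instance Definition _ := GRing.Zmodule_isPzRing.Build (tensor A B)
  tmulA tmul1l tmul1r tmulDl tmulDr.

End TensorAlgebra.

HB.mixin Record isHopfAlgebra (K : fieldType) A of GRing.Algebra K A := {
  comul : A -> tensor A A;
  counit : A -> K;
  antipode : A -> A;
  comul_linear : linear comul;
  comul_monoid_morphism : monoid_morphism comul;
  counit_scalar : scalar counit;
  counit_monoid_morphism : monoid_morphism counit;
  antipode_linear : linear antipode;
  comulA : forall x,
    tassoc (tmap comul id (comul x)) = tmap id comul (comul x);
  comul_counitl : forall x, tlift (fun a b => counit a *: b) (comul x) = x;
  comul_counitr : forall x, tlift (fun a b => counit b *: a) (comul x) = x;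
  antipodel : forall x,
    tlift (fun a b => antipode a * b) (comul x) = (counit x)%:A;
  antipoder : forall x,
    tlift (fun a b => a * antipode b) (comul x) = (counit x)%:A
}.

#[short(type="hopfAlgType")]
HB.structure Definition HopfAlgebra (K : fieldType) :=
  { A of GRing.Algebra K A & isHopfAlgebra K A }.

HB.instance Definition _ (K : fieldType) (A : hopfAlgType K) :=
  GRing.isLinear.Build K A (tensor A A) *:%R (@comul K A) comul_linear.
HB.instance Definition _ (K : fieldType) (A : hopfAlgType K) :=
  GRing.isMonoidMorphism.Build A (tensor A A) (@comul K A) comul_monoid_morphism.
HB.instance Definition _ (K : fieldType) (A : hopfAlgType K) :=
  GRing.isLinear.Build K A K *%R (@counit K A) counit_scalar.
HB.instance Definition _ (K : fieldType) (A : hopfAlgType K) :=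
  GRing.isMonoidMorphism.Build A K (@counit K A) counit_monoid_morphism.
HB.instance Definition _ (K : fieldType) (A : hopfAlgType K) :=
  GRing.isLinear.Build K A A *:%R (@antipode K A) antipode_linear.

Local Open Scope classical_set_scope.

Section Semisimple.
Variable A : nzRingType.

Definition left_ideal (I : set A) : Prop :=
  [/\ I 0, (forall x y, I x -> I y -> I (x + y)) & (forall a x, I x -> I (a * x))].

Definition simple_left_ideal (I : set A) : Prop :=
  [/\ left_ideal I, (exists2 x, I x & x != 0) &
      forall J : set A, left_ideal J -> J `<=` I -> J = [set 0] \/ J = I].

(* The left regular module is a direct sum of simple submodules. A finite     *)
(* family suffices, since 1 lies in the sum of finitely many summands.        *)
Definition semisimple_ring : Prop :=
  exists (n : nat) (I : 'I_n -> set A),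
    (forall i, simple_left_ideal (I i)) /\
    (forall a, exists! x : {ffun 'I_n -> A},
        (forall i, I i (x i)) /\ a = \sum_i x i).

End Semisimple.

Section CoidealSubalgebras.
Variables (K : fieldType) (A : hopfAlgType K).
Implicit Types (N : set A) (P x : A).

(* The image of A ⊗ N in A ⊗ A. *)
Definition tensor_subspace N : set (tensor A A) :=
  [set t | exists2 s : seq (A * A),
     (forall p, p \in s -> N p.2) & t = \sum_(p <- s) p.1 ⊗ p.2].

Definition left_coideal_subalgebra N : Prop :=
  subalg_closed [pred x | x \in N] /\
  (forall x, N x -> tensor_subspace N (comul x)).

Definition left_coideal_subalgebras : set (set A) :=
  [set N | left_coideal_subalgebra N].

Definition projection P : Prop := P * P = P.

Definition central_projection N P : Prop :=
  [/\ N P, projection P & forall x, N x -> P * x = x * P].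

Definition right_grouplike_projection P : Prop :=
  [/\ P != 0, projection P,
      comul P * (1 ⊗ P) = P ⊗ P & P ⊗ P = (1 ⊗ P) * comul P].

Definition right_grouplike_projections : set A :=
  [set P | right_grouplike_projection P].

Definition is_coideal_proj N P : Prop :=
  central_projection N P /\
  N `&` [set x | counit x = 0] = [set (1 - P) * x | x in N].

(* The value is 0 when no such projection exists. *)
Definition coideal_proj N : A := xget 0 [set P | is_coideal_proj N P].

Definition proj_coideal P : set A :=
  [set x | comul x * (1 ⊗ P) = x ⊗ P /\ (1 ⊗ P) * comul x = x ⊗ P].

End CoidealSubalgebras.

(* Main.v *)
Require Import Defs.
From HB Require Import structures.
From mathcomp Require Import all_boot all_order all_algebra falgebra.
From mathcomp Require Import boolp classical_sets functions.
From mathcomp Require Import zify.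

(** Why the theorem holds. Write N^+ for the kernel of the counit on a left
    coideal subalgebra N. All comes down to producing in N an element P with
    counit P = 1 and x P = P x = counit x P for x in N (a two-sided integral):
    such a P is the only candidate for the central projection of N. From
    comul N in A ⊗ N one reads off that P is right group-like and that N lies in
    the coideal of P; conversely, for a group-like P, applying the counit to the
    first leg of the defining equations shows that P is a two-sided integral of
    its coideal.

    Finite dimension. One of the simple summands of A meets the kernel of the
    counit trivially, which gives a left integral L of A with counit L = 1
    ([semisimple_integral]). The identity a L2 ⊗ L1 = L2 ⊗ S(a) L1 makes the span
    of the second legs of comul L a left ideal, and S(L1) L2 = 1 puts 1 in it
    ([integral_finite_dimensional]).

    The duality. Let Y be a nonzero subspace of A, stable under N and under the
    operators x |-> f(x1) x2; below, Y is N or A. For left ideals U of N compare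
    the codimension of U with the dimension of its annihilator in Y. The claim
    ([annihilator_duality]) is that the ratio is the same for all U and that
    every N-linear map from a principal left ideal to Y extends to N. It replaces
    freeness of A over N (Skryabin) and is proved in the same spirit. Let q be
    the largest value of dim ann U / codim U over proper U. Since an annihilator
    is a space of homomorphisms, left exactness gives the inequality with q for
    all finitely generated N-modules T in place of N/U, and modules attaining
    equality have cyclic submodules which attain it too. For a tight U, A ⊗ N/U
    with diagonal action is again tight, because dim Hom_N (A ⊗ T, Y) is at least
    dim A * dim Hom_N (T, Y). Hence the smallest tight left ideal I annihilates
    A ⊗ N/I, which says comul I in A ⊗ I. If the counit vanishes on I then I = 0;
    if not, 1 lies in A I, so I has no annihilator, forcing I = N, against the
    existence of a proper tight ideal. So 0 is tight, hence so is everything.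

    The integral ([coideal_integral]). With Y = N and U = N^+, the left integrals
    of N form a line. Let l span it. With Y = A, the map l |-> L extends, so
    L = l a for some a, and counit l is nonzero. Normalize l to P. For x in N,
    P x is again a left integral, hence a multiple of P, and the multiple is
    counit x.

    Injectivity ([coideal_eq]). If N lies in N' with the same P, the duality with
    Y = A and U = N^+ gives dim N * dim (P A) = dim A = dim N' * dim (P A). This
    applies to N and the coideal of its projection. *)

Set Implicit Arguments.
Unset Strict Implicit.
Unset Printing Implicit Defensive.

Import GRing.Theory.
Local Open Scope ring_scope.

(** * Subspaces, linear maps and dual families *)

Section VspaceOf.
Variables (K : fieldType) (V : vectType K).

(** A subspace of maximal dimension inside P absorbs every vector of P. *)
Lemma vspace_of_closed (P : V -> Prop) :
    P 0 -> (forall a u v, P u -> P v -> P (a *: u + v)) ->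
  exists U : {vspace V}, forall v, v \in U <-> P v.
Proof.
move=> P0 Plin.
pose Q n := `[< exists2 U : {vspace V}, \dim U = n & forall v, v \in U -> P v >].
have exQ : exists n, Q n.
  exists 0%N; apply/asboolP; exists 0%VS; first exact: dimv0.
  by move=> v; rewrite memv0 => /eqP ->.
have leQ n : Q n -> (n <= \dim {:V})%N.
  by move=> /asboolP[U <- _]; exact: dimvS (subvf U).
have [n /asboolP[U dU UP] nmax] := ex_maxnP exQ leQ.
exists U => v; split=> [/UP //|Pv]; apply: contrapT => /negP vU.
have : (\dim (U + <[v]>)%VS <= n)%N.
  apply: nmax; apply/asboolP; exists (U + <[v]>)%VS => // w.
  by case/memv_addP=> u /UP Pu [w' /vlineP[a ->] ->]; rewrite addrC; apply: Plin.
rewrite -dU => le_dim; have /eqP UE : U == (U + <[v]>)%VS.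
  by rewrite eqEdim addvSl.
by case/negP: vU; rewrite UE; apply: (subvP (addvSr _ _)); apply: memv_line.
Qed.

(** Passing from predicates to subspaces avoids exhibiting generators; the value
    is meaningful only when P is closed under linear combinations. *)
Definition vspace_of (P : V -> Prop) : {vspace V} :=
  xget 0%VS [set U : {vspace V} | forall v, v \in U <-> P v]%classic.

Lemma mem_vspace_of (P : V -> Prop) :
    P 0 -> (forall a u v, P u -> P v -> P (a *: u + v)) ->
  forall v, v \in vspace_of P <-> P v.
Proof.
by move=> P0 /(vspace_of_closed P0) [U PU]; rewrite /vspace_of; case: xgetP => [_ _ //|/(_ U)].
Qed.

Lemma linear_fun0 (W : vectType K) (f : V -> W) : linear f -> f 0 = 0.
Proof. by move=> /zmod_morphism_linear flin; rewrite -[in LHS](subrr 0) flin subrr. Qed.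

Lemma lfun_of_linear (W : vectType K) (f : V -> W) :
  linear f -> exists g : 'Hom(V, W), g =1 f.
Proof.
move=> flin; pose F : {linear V -> W} :=
  HB.pack f (GRing.isLinear.Build K V W *:%R f flin).
by exists (linfun F) => v; rewrite lfunE.
Qed.

End VspaceOf.

Section Functionals.
Variables (K : fieldType) (V : lmodType K).

(** A maximal linearly closed set avoiding v is a hyperplane complementary to the
    line of v; the functional is the coordinate along v. The dimension may be
    infinite, so this needs Zorn. *)
Lemma exists_functional (v : V) : v != 0 -> exists2 f : V -> K, scalar f & f v = 1.
Proof.
move=> v0.
pose P (M : set V) := (forall a u w, M u -> M w -> M (a *: u + w)) /\ ~ M v.
(* P holds of the empty set, so the empty chain needs no separate treatment; that
   0 belongs to M is recovered below from maximality. *)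
have [|M [[Mlin Mv] Mmax]] := @Zorn_bigcup V P.
  move=> F FP Ftot; split=> [a u w [X FX Xu] [Z FZ Zw]|[X FX]]; last first.
    by case: (FP _ FX).
  have [XZ|ZX] := Ftot _ _ FX FZ.
    by exists Z => //; have [Zlin _] := FP _ FZ; apply: Zlin => //; apply: XZ.
  by exists X => //; have [Xlin _] := FP _ FX; apply: Xlin => //; apply: ZX.
have extend z : ~ M z -> exists a m, (M m \/ m = 0) /\ v = a *: z + m.
  move=> Mz; pose M' w := exists a m, (M m \/ m = 0) /\ w = a *: z + m.
  apply: contrapT => M'v; case: (Mmax M').
    split=> [w Mw|/(_ z) M'M]; first by exists 0, w; split; [left | rewrite scale0r add0r].
    by case: Mz; apply: M'M; exists 1, 0; split; [right | rewrite scale1r addr0].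
  split=> // a _ _ [b [m [Mm ->]]] [b' [m' [Mm' ->]]].
  exists (a * b + b'), (a *: m + m'); split; last first.
    by rewrite scalerDr scalerDl scalerA addrACA.
  case: Mm Mm' => [Mm|->] [Mm'|->]; rewrite ?scaler0 ?add0r ?addr0; try by [left|right].
    by left; apply: Mlin.
  by left; have := Mlin (a - 1) m m Mm Mm; rewrite scalerBl scale1r subrK.
have M0 : M 0.
  apply: contrapT => /extend[a [m [Mm vE]]]; rewrite scaler0 add0r in vE.
  by case: Mm => [|m0]; [rewrite -vE | rewrite vE m0 eqxx in v0].
have {}extend z : exists a, M (z - a *: v).
  case: (EM (M z)) => [Mz|/extend[a [m [Mm vE]]]].
    by exists 0; rewrite scale0r subr0.
  have {}Mm : M m by case: Mm => [//|->].
  have a0 : a != 0.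
    by apply: contra_notN Mv => /eqP a0; rewrite vE a0 scale0r add0r.
  exists a^-1; rewrite vE scalerDr scalerA mulVf // scale1r opprD addNKr.
  by rewrite -scaleNr -[_ *: _]addr0; apply: Mlin.
pose f z := xget 0 [set a | M (z - a *: v)]%classic.
have fM z : M (z - f z *: v).
  by rewrite /f; case: xgetP => [a _ //|nM]; have [a /(nM a)] := extend z.
have f_uniq z a : M (z - a *: v) -> f z = a.
  move=> Mz; apply/eqP; rewrite -subr_eq0; apply: contra_notT Mv => d0.
  have /(Mlin (f z - a)^-1 _ 0)/(_ M0) := Mlin (-1) _ _ (fM z) Mz.
  rewrite addr0 scaleN1r opprB addrA subrK -scalerBl.
  by rewrite scalerA mulVf // scale1r.
exists f => [a u w|]; apply: f_uniq; last by rewrite scale1r subrr.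
by rewrite scalerDl -scalerA opprD addrACA -scalerBr; apply: Mlin.
Qed.

Lemma scalar0 (f : V -> K) : scalar f -> f 0 = 0.
Proof. by move=> /(_ (-1) 0 0); rewrite scaler0 addr0 mulN1r addNr. Qed.

Lemma scalar_sum (f : V -> K) I (r : seq I) (a : I -> K) (b : I -> V) :
  scalar f -> f (\sum_(i <- r) a i *: b i) = \sum_(i <- r) a i * f (b i).
Proof.
move=> flin; elim: r => [|i r IHr]; first by rewrite !big_nil scalar0.
by rewrite !big_cons flin IHr.
Qed.

(** A finite family has a basis of its span together with dual functionals defined
    on the whole space; this is what allows reading off coefficients of tensors
    before A is known to be finite-dimensional. *)
Lemma dual_family (s : seq V) :
  exists n (b : 'I_n -> V) (c : 'I_n -> V -> K),
    [/\ forall i, scalar (c i), forall i j, c i (b j) = (i == j)%:R &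
        forall v, v \in s -> v = \sum_i c i v *: b i].
Proof.
elim: s => [|v s [n [b [c [clin cb cs]]]]].
  by exists 0%N, (fun=> 0), (fun _ _ => 0); split=> // -[].
pose r := v - \sum_i c i v *: b i.
have [r0|r0] := eqVneq r 0.
  exists n, b, c; split=> // w; rewrite inE => /predU1P[->|/cs//].
  by apply/eqP; rewrite -subr_eq0 -/r r0.
have csum i (g : 'I_n -> K) : c i (\sum_j g j *: b j) = g i.
  rewrite (scalar_sum _ _ _ (clin i)) (bigD1 i) //= cb eqxx mulr1.
  by rewrite big1 ?addr0 // => j /negPf ji; rewrite cb eq_sym ji mulr0.
have [f flin fr] := exists_functional r0.
have cr i : c i r = 0.
  have -> : r = -1 *: (\sum_j c j v *: b j) + v by rewrite scaleN1r addrC.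
  by rewrite clin csum mulN1r addNr.
(* subtracting the projection on the span of b makes the functional vanish on b *)
have [g [glin gr gb]] : exists g : V -> K, [/\ scalar g, g r = 1 & forall i, g (b i) = 0].
  exists (fun w => f (w - \sum_i c i w *: b i)); split.
  - move=> a u w; rewrite -flin; congr f.
    rewrite scalerBr addrACA -opprD; congr (_ - _).
    rewrite scaler_sumr -big_split; apply: eq_bigr => i _.
    by rewrite clin scalerDl scalerA.
  - by rewrite big1 ?subr0 // => i _; rewrite cr scale0r.
  move=> i; rewrite (bigD1 i) //= cb eqxx scale1r big1 ?addr0 ?subrr.
    exact: scalar0.
  by move=> j /negPf ji; rewrite cb ji scale0r.
have gsum (u : V) : g (\sum_i c i u *: b i) = 0.
  by rewrite (scalar_sum _ _ _ glin) big1 // => i _; rewrite gb mulr0.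
exists n.+1, (fun i => oapp b r (unlift ord0 i)), (fun i => oapp c g (unlift ord0 i)).
split=> [i|i j|w].
- by case: unliftP => [j _|_] /=; [apply: clin | apply: glin].
- case: (unliftP ord0 i) => [i' ->|->]; case: (unliftP ord0 j) => [j' ->|->] //=.
rewrite big_ord_recl unlift_none /=; under eq_bigr do rewrite liftK /=.
rewrite inE => /predU1P[->|/cs wE].
  have vE : v = r + \sum_i c i v *: b i by rewrite subrK.
  have -> : g v = 1 by rewrite vE -[r]scale1r glin gr gsum mul1r addr0.
  by rewrite scale1r -vE.
have -> : g w = 0 by rewrite wE gsum.
by rewrite scale0r add0r.
Qed.

End Functionals.

(** * Duality between left ideals and their annihilators *)

Section Pairings.
Variables (K : fieldType) (A : falgType K) (N Y : {vspace A}).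
Hypothesis N1 : 1 \in N.
Hypothesis NM : forall x y, x \in N -> y \in N -> x * y \in N.
Hypothesis NY : forall x y, x \in N -> y \in Y -> x * y \in Y.

(** A finite-dimensional N-module [pdom] with a space [pcod] of N-linear maps from
    it to Y, the evaluation being [peval]. Two instances matter: N itself with
    maps x |-> x y, and the free module N^n with maps given by vectors of Y^n. *)
Record pairing (V H : vectType K) := Pairing {
  pdom : {vspace V};
  pcod : {vspace H};
  pact : A -> V -> V;
  peval : V -> H -> A;
  pact_linear : forall v, linear (pact^~ v);
  pact_linearr : forall x, linear (pact x);
  pact1 : forall v, pact 1 v = v;
  pactA : forall x y v, pact (x * y) v = pact x (pact y v);
  pact_dom : forall x v, x \in N -> v \in pdom -> pact x v \in pdom;
  peval_linearl : forall h, linear (peval^~ h);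
  peval_linearr : forall v, linear (peval v);
  peval_act : forall x v h, peval (pact x v) h = x * peval v h;
  peval_cod : forall v h, v \in pdom -> h \in pcod -> peval v h \in Y;
  peval_nondeg : forall h,
    h \in pcod -> (forall v, v \in pdom -> peval v h = 0) -> h = 0
}.

#[local] Obligation Tactic := idtac.
Program Definition regular_pairing : pairing A A :=
  @Pairing A A N Y *%R *%R _ _ _ _ _ _ _ _ _ _.
Next Obligation. by move=> v a x y; rewrite mulrDl scalerAl. Qed.
Next Obligation. by move=> v a x y; rewrite mulrDr scalerAr. Qed.
Next Obligation. by move=> v; rewrite mul1r. Qed.
Next Obligation. by move=> x y v; rewrite mulrA. Qed.
Next Obligation. by move=> x y; apply: NM. Qed.
Next Obligation. by move=> v a x y; rewrite mulrDl scalerAl. Qed.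
Next Obligation. by move=> v a x y; rewrite mulrDr scalerAr. Qed.
Next Obligation. by move=> x y v; rewrite mulrA. Qed.
Next Obligation. by move=> x y; apply: NY. Qed.
Next Obligation. by move=> h _ hN; rewrite -[h]mul1r hN. Qed.

Section OnePairing.
Variables (V H : vectType K) (b : pairing V H).

(** These are the homomorphisms to Y from the quotient by W. *)
Definition orth (W : {vspace V}) : {vspace H} :=
  vspace_of (fun h => h \in pcod b /\ forall w, w \in W -> peval b w h = 0).

Lemma orthP W h :
  h \in orth W <-> h \in pcod b /\ forall w, w \in W -> peval b w h = 0.
Proof.
apply: mem_vspace_of => [|a u v [uH uW] [vH vW]]; split=> [|w wW].
- exact: mem0v.
- by rewrite (linear_fun0 (peval_linearr b w)).
- by rewrite memvD ?memvZ.
by rewrite (peval_linearr b w) uW ?vW // scaler0 addr0.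
Qed.

Definition submodule (W : {vspace V}) : Prop :=
  (W <= pdom b)%VS /\ forall x w, x \in N -> w \in W -> pact b x w \in W.

(** The annihilator in N of the class of t modulo W. *)
Definition colon (W : {vspace V}) (t : V) : {vspace A} :=
  vspace_of (fun x => x \in N /\ pact b x t \in W).

Lemma colonP W t x : x \in colon W t <-> x \in N /\ pact b x t \in W.
Proof.
apply: mem_vspace_of => [|a u v [uN uW] [vN vW]]; split.
- exact: mem0v.
- by rewrite (linear_fun0 (pact_linear b t)) mem0v.
- by rewrite memvD ?memvZ.
by rewrite (pact_linear b t) memvD ?memvZ.
Qed.

End OnePairing.

Notation lideal := (submodule regular_pairing).
Notation rann := (orth regular_pairing).

Lemma colon_lideal (V H : vectType K) (b : pairing V H) W t :
  submodule b W -> lideal (colon b W t).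
Proof.
move=> [WD Wact]; split=> [|x u xN /colonP[uN uW]].
  by apply/subvP => x /colonP[].
by apply/colonP; split; [exact: NM | rewrite pactA; apply: Wact].
Qed.

(** Adding one generator t to W: the submodule W + N t modulo W is cyclic,
    isomorphic to N modulo the colon ideal, so evaluation at t maps the orthogonal
    of W to the annihilator of that ideal, with kernel the orthogonal of W + N t.
    Equality of dimensions means that this evaluation is onto. *)
Lemma submodule_step (V H : vectType K) (b : pairing V H) W t :
    submodule b W -> t \in pdom b ->
  exists W', [/\ submodule b W', (W <= W')%VS, t \in W',
    (\dim W' + \dim (colon b W t) = \dim W + \dim N)%N &
    [/\ forall Z, submodule b Z -> (W <= Z)%VS -> t \in Z -> (W' <= Z)%VS,
    (\dim (orth b W) <= \dim (orth b W') + \dim (rann (colon b W t)))%N &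
    (\dim (orth b W') + \dim (rann (colon b W t)) <= \dim (orth b W))%N ->
    forall y, y \in rann (colon b W t) ->
      exists2 h, h \in orth b W & peval b t h = y]].
Proof.
move=> Wsub tD; have [WD Wact] := Wsub.
have [g gE] := lfun_of_linear (pact_linear b t).
have [e eE] := lfun_of_linear (peval_linearr b t).
exists (W + g @: N)%VS.
have e_im : (e @: orth b W <= rann (colon b W t))%VS.
  apply/subvP => _ /memv_imgP[h /orthP[hH hW] ->]; rewrite eE.
  apply/orthP; split=> [|x /colonP[xN xW]]; first exact: peval_cod.
  by rewrite /= -peval_act hW.
have e_ker : (orth b W :&: lker e <= orth b (W + g @: N))%VS.
  apply/subvP => h; rewrite memv_cap memv_ker eE => /andP[/orthP[hH hW] /eqP eh].
  apply/orthP; split=> // _ /memv_addP[w wW [_ /memv_imgP[x xN ->] ->]].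
  rewrite -[w]scale1r (peval_linearl b) gE peval_act eh mulr0 addr0.
  by rewrite scale1r hW.
have dim_e := limg_ker_dim e (orth b W).
split.
- split=> [|x _ xN /memv_addP[w wW [_ /memv_imgP[y yN ->] ->]]].
    rewrite subv_add WD; apply/subvP => _ /memv_imgP[x xN ->].
    by rewrite gE pact_dom.
  rewrite -[w]scale1r (pact_linearr b) scale1r gE -pactA -gE.
  by rewrite memv_add ?Wact ?memv_img ?NM.
- exact: addvSl.
- apply: (subvP (addvSr _ _)); apply/memv_imgP; exists 1 => //.
  by rewrite gE pact1.
- have := dimv_sum_cap W (g @: N); have := limg_ker_dim g N.
  have := limg_ker_dim g (colon b W t).
  have -> : (g @: colon b W t = W :&: g @: N)%VS.
    apply/eqP; rewrite eqEsubv; apply/andP; split; apply/subvP => v.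
      by case/memv_imgP=> x /colonP[xN xW] ->; rewrite memv_cap memv_img // gE xW.
    rewrite memv_cap => /andP[vW /memv_imgP[x xN vE]]; rewrite vE memv_img //.
    by apply/colonP; rewrite -gE -vE.
  have -> : (colon b W t :&: lker g = N :&: lker g)%VS.
    apply/eqP; rewrite eqEsubv; apply/andP; split; apply/subvP => v.
      by rewrite !memv_cap => /andP[/colonP[-> _]].
    rewrite !memv_cap memv_ker => /andP[vN gv]; rewrite gv andbT; apply/colonP.
    by rewrite -gE (eqP gv) mem0v.
  by lia.
split.
- move=> Z [_ Zact] WZ tZ; rewrite subv_add WZ; apply/subvP => _ /memv_imgP[x xN ->].
  by rewrite gE Zact.
- by have := dimvS e_im; have := dimvS e_ker; lia.
move=> le_dim y; have /eqP <- : (e @: orth b W == rann (colon b W t))%VS.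
  by rewrite eqEdim e_im; have := dimvS e_ker; lia.
by case/memv_imgP=> h hW ->; exists h => //; rewrite eE.
Qed.

(** The ratio p / c bounds dim (rann U) / codim U over all left ideals U. It is
    convenient to speak of the potential c * dim (orth W) + p * dim W. *)
Section Potential.
Variables c p : nat.
Hypothesis c_gt0 : (0 < c)%N.
Hypothesis rann_bound : forall U, lideal U ->
  (c * \dim (rann U) + p * \dim U <= p * \dim N)%N.

(** W is tight when it attains the bound [potential_bound]. *)
Definition tight (V H : vectType K) (b : pairing V H) W : Prop :=
  (p * \dim (pdom b) <= c * \dim (orth b W) + p * \dim W)%N.

(** Each step of [submodule_step] increases the potential, because the bound holds
    for the colon ideal of the step; iterate from W up to the larger submodule. *)
Lemma potential_mono (V H : vectType K) (b : pairing V H) W W' :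
    submodule b W -> submodule b W' -> (W <= W')%VS ->
  (c * \dim (orth b W) + p * \dim W <= c * \dim (orth b W') + p * \dim W')%N.
Proof.
move=> Wsub W'sub; have [n leWn] := ubnP (\dim W' - \dim W).
elim: n W Wsub leWn => [//|n IHn] W Wsub leWn WW'.
have [W'W|] := boolP (W' <= W)%VS.
  by have -> : W = W' by apply/eqP; rewrite eqEsubv WW'.
case/subvPn => t tW' tW; have [W'D _] := W'sub.
have [Z [Zsub WZ tZ dimZ [Zmin dimo _]]] := submodule_step Wsub (subvP W'D _ tW').
have ZW' := Zmin _ W'sub WW' tW'.
have ltWZ : (\dim W < \dim Z)%N.
  rewrite ltnNge; apply: contra tW => leZW.
  by have /eqP -> : W == Z by rewrite eqEdim WZ.
have bnd := rann_bound (colon_lideal t Wsub).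
have leZW' := dimvS ZW'.
have leZ := IHn Z Zsub _ ZW'; have {leZ} := leZ ltac:(lia).
apply: leq_trans.
have := congr1 (muln p) dimZ; rewrite !mulnDr.
have := leq_mul (leqnn c) dimo; rewrite mulnDr; lia.
Qed.

Lemma tight_superset (V H : vectType K) (b : pairing V H) W W' :
  submodule b W -> submodule b W' -> (W <= W')%VS -> tight b W -> tight b W'.
Proof. by move=> Ws W's WW'; move/leq_trans; apply; apply: potential_mono. Qed.

Lemma orth_dom (V H : vectType K) (b : pairing V H) : orth b (pdom b) = 0%VS.
Proof.
apply/eqP; rewrite -subv0; apply/subvP => h /orthP[hH h0].
by rewrite memv0; apply/eqP/(peval_nondeg hH).
Qed.

Lemma potential_bound (V H : vectType K) (b : pairing V H) W :
  submodule b W -> (c * \dim (orth b W) + p * \dim W <= p * \dim (pdom b))%N.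
Proof.
move=> Wsub; have [WD _] := Wsub.
have Dsub : submodule b (pdom b) by split=> [|x w]; [exact: subvv | exact: pact_dom].
by have := potential_mono Wsub Dsub WD; rewrite orth_dom dimv0 muln0.
Qed.

(** Equality at W forces equality at every stage of [submodule_step]: the colon
    ideal is tight and evaluation at t is onto. *)
Lemma tight_colon (V H : vectType K) (b : pairing V H) W t :
    submodule b W -> t \in pdom b -> tight b W ->
  tight regular_pairing (colon b W t) /\
  forall y, y \in rann (colon b W t) ->
    exists2 h, h \in orth b W & peval b t h = y.
Proof.
move=> Wsub tD Wtight.
have [Z [Zsub WZ _ dimZ [_ dimo surj]]] := submodule_step Wsub tD.
have bndZ := potential_bound Zsub.
have bndC := rann_bound (colon_lideal t Wsub).
have eqZ := congr1 (muln p) dimZ; rewrite !mulnDr in eqZ.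
have leo := leq_mul (leqnn c) dimo; rewrite mulnDr in leo.
rewrite /tight in Wtight; split; first by rewrite /tight /=; lia.
by apply: surj; rewrite -(leq_pmul2l c_gt0) mulnDr; lia.
Qed.

(** Modularity of dimensions, applied to the ideals and to their annihilators:
    the annihilators of U and U' meet in that of U + U', which obeys the bound. *)
Lemma tight_cap U U' : lideal U -> lideal U' ->
  tight regular_pairing U -> tight regular_pairing U' ->
  tight regular_pairing (U :&: U').
Proof.
move=> Usub U'sub; rewrite /tight /= => tU tU'.
have UU'sub : lideal (U + U')%VS.
  case: Usub U'sub => [UN Uact] [U'N U'act]; split; first by rewrite subv_add UN.
  move=> x _ xN /memv_addP[u uU [u' u'U ->]].
  by rewrite /= mulrDr memv_add ?Uact ?U'act.
have bnd := potential_bound UU'sub.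
have := dimv_sum_cap U U'.
have := dimv_sum_cap (rann U) (rann U').
have -> : (rann U :&: rann U' = rann (U + U'))%VS.
  apply/eqP; rewrite eqEsubv; apply/andP; split; apply/subvP => y.
    rewrite memv_cap => /andP[/orthP[yY yU] /orthP[_ yU']]; apply/orthP; split=> //.
    move=> _ /memv_addP[u uU [u' u'U ->]]; rewrite /= mulrDl.
    by rewrite (yU u uU : u * y = 0) (yU' u' u'U : u' * y = 0) addr0.
  case/orthP=> yY yUU'; rewrite memv_cap; apply/andP; split; apply/orthP; split=> // u uU.
    by apply: yUU'; apply: (subvP (addvSl _ _)).
  by apply: yUU'; apply: (subvP (addvSr _ _)).
have : (\dim (rann U + rann U') <= \dim (rann (U :&: U')))%N.
  apply: dimvS; rewrite subv_add; apply/andP; split; apply/subvP => y /orthP[yY yU];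
    by apply/orthP; split=> // u; rewrite memv_cap => /andP[uU uU']; apply: yU.
rewrite /= in bnd.
move=> /(leq_mul (leqnn c)) + /(congr1 (muln c)) + /(congr1 (muln p)).
rewrite !mulnDr; lia.
Qed.

End Potential.

Lemma zero_lideal : lideal 0%VS.
Proof.
split=> [|x u _]; first exact: sub0v.
by rewrite !memv0 => /eqP ->; rewrite /= mulr0.
Qed.

Lemma rann0 : rann 0 = Y.
Proof.
apply/vspaceP => y; apply/idP/idP => [/orthP[]//|yY]; apply/orthP; split=> // u.
by rewrite memv0 => /eqP ->; rewrite /= mul0r.
Qed.

(** The dimensions involved are bounded, so the ratio dim (rann U) / codim U takes
    finitely many values over proper left ideals and has a maximum p / c, attained
    by a tight ideal; p > 0 since the zero ideal has annihilator Y. *)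
Lemma exists_extremal_ratio : Y != 0%VS ->
  exists c p, [/\ (0 < c)%N, (0 < p)%N,
    forall U, lideal U -> (c * \dim (rann U) + p * \dim U <= p * \dim N)%N &
    exists U, [/\ lideal U, tight c p regular_pairing U & U != N]].
Proof.
move=> Yn0; pose m := \dim {:A}.
have le_m (U : {vspace A}) : (\dim U < m.+1)%N by rewrite ltnS dimvS ?subvf.
have le_cod (U : {vspace A}) : (\dim N - \dim U < m.+1)%N by rewrite (leq_ltn_trans (leq_subr _ _)).
pose Q (i : 'I_m.+1 * 'I_m.+1) := `[< exists U, [/\ lideal U, U != N,
  \dim (rann U) = i.1 & \dim N - \dim U = i.2]%N >].
have sub0 := zero_lideal.
have Nn0 : 0%VS != N.
  by apply: contraTneq N1 => <-; rewrite memv0 oner_neq0.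
pose ip U := (Ordinal (le_m (rann U)), Ordinal (le_cod U)).
have Q0 : Q (ip 0%VS) by apply/asboolP; exists 0%VS.
case: (@Order.TotalTheory.arg_maxP _ _ _ _ Q (fun i => i.1%:R / i.2%:R : rat) Q0).
move=> [i j] /asboolP[U0 [U0sub U0N /= iE jE]] maxi.
have U0le : (U0 <= N)%VS by case: U0sub.
have ltU U : lideal U -> U != N -> (0 < \dim N - \dim U)%N.
  move=> [UN _]; rewrite subn_gt0 ltnNge; apply: contra => leNU.
  by rewrite eqEdim UN.
have j_gt0 : (0 < j)%N by rewrite -jE ltU.
have bound U : lideal U -> (j * \dim (rann U) + i * \dim U <= i * \dim N)%N.
  move=> Usub; have [->|UN] := eqVneq U N.
    by rewrite (orth_dom regular_pairing) dimv0 muln0.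
  have QU : Q (ip U) by apply/asboolP; exists U.
  have := maxi _ QU; rewrite /= Num.Theory.ler_pdivlMr ?Num.Theory.ltr0n //.
  rewrite mulrAC Num.Theory.ler_pdivrMr ?Num.Theory.ltr0n ?ltU //.
  rewrite -!natrM Num.Theory.ler_nat mulnBr => le_UU0.
  have /(leq_mul (leqnn i)) : (\dim U <= \dim N)%N by apply: dimvS; case: Usub.
  by lia.
exists j, i; split=> //; last first.
  exists U0; split=> //; rewrite /tight iE -jE /= -[X in (X <= _)%N]/(i * _)%N.
  have := dimvS U0le; rewrite mulnBl; have := leq_mul (leqnn i) (dimvS U0le).
  by lia.
have := bound _ sub0; rewrite dimv0 muln0 addn0.
rewrite rann0; case: (posnP i) => // ->; rewrite mul0n leqn0 muln_eq0 dimv_eq0 (negPf Yn0) orbF.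
by rewrite -[_ == 0%N]negbK -lt0n j_gt0.
Qed.

(** A tight ideal of least dimension is contained in all the others, as tight ideals
    are closed under intersection. *)
Lemma tight_min c p : (0 < c)%N ->
    (forall U, lideal U -> (c * \dim (rann U) + p * \dim U <= p * \dim N)%N) ->
    (exists U, lideal U /\ tight c p regular_pairing U) ->
  exists I, [/\ lideal I, tight c p regular_pairing I &
    forall U, lideal U -> tight c p regular_pairing U -> (I <= U)%VS].
Proof.
move=> c_gt0 bound [U0 [U0sub tU0]].
pose Q n := `[< exists U, [/\ lideal U, tight c p regular_pairing U & \dim U = n] >].
have exQ : exists n, Q n by exists (\dim U0); apply/asboolP; exists U0.
have [n /asboolP[I [Isub tI dI]] nmin] := ex_minnP exQ.
exists I; split=> // U Usub tU; apply/capv_idPl/eqP; rewrite eqEdim capvSl dI.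
apply: nmin; apply/asboolP; exists (I :&: U)%VS; split=> //.
  case: Isub Usub => [IN Iact] [_ Uact]; split; first exact: subv_trans (capvSl _ _) IN.
  by move=> x u xN; rewrite !memv_cap => /andP[uI uU]; rewrite Iact ?Uact.
exact: tight_cap.
Qed.

Section Power.
Variable n : nat.

Definition power (U : {vspace A}) : {vspace {ffun 'I_n -> A}} :=
  vspace_of (fun f : {ffun 'I_n -> A} => forall i, f i \in U).

Lemma powerP U (f : {ffun 'I_n -> A}) : f \in power U <-> forall i, f i \in U.
Proof.
apply: mem_vspace_of => [i|a u v uU vU i]; first by rewrite ffunE mem0v.
by rewrite !ffunE memvD ?memvZ ?uU ?vU.
Qed.

Lemma dim_power U : \dim (power U) = (n * \dim U)%N.
Proof.
have flin : linear (fun f : {ffun 'I_n -> subvs_of U} => [ffun i => vsval (f i)]).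
  by move=> a u v; apply/ffunP => i; rewrite !ffunE linearP.
have [g gE] := lfun_of_linear flin.
have kg : (fullv :&: lker g = 0)%VS.
  apply/eqP; rewrite -subv0; apply/subvP => f; rewrite memv_cap memv_ker gE memv0.
  move=> /andP[_ /eqP f0]; apply/eqP/ffunP => i; apply: val_inj.
  by have /ffunP/(_ i) := f0; rewrite !ffunE.
have -> : power U = (g @: fullv)%VS.
  apply/vspaceP => f; apply/idP/idP => [/powerP fU|/memv_imgP[h _ ->]].
    apply/memv_imgP; exists [ffun i => vsproj U (f i)]; first exact: memvf.
    by rewrite gE; apply/ffunP => i; rewrite !ffunE vsprojK.
  by apply/powerP => i; rewrite gE ffunE; apply: subvsP.
rewrite (limg_dim_eq kg) dimvf /dim /= card_ord.
by [].
Qed.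

Local Notation An := {ffun 'I_n -> A}.

Definition unit_vec (i : 'I_n) : An := [ffun j => (j == i)%:R].

Lemma unit_vec_power i : unit_vec i \in power N.
Proof. by apply/powerP => j; rewrite ffunE; case: eqP => _; rewrite ?N1 ?mem0v. Qed.

Program Definition power_pairing : pairing An An :=
  @Pairing An An (power N) (power Y) (fun x f => [ffun i => x * f i])
    (fun f h => \sum_i f i * h i) _ _ _ _ _ _ _ _ _ _.
Next Obligation.
by move=> v a x y; apply/ffunP => i; rewrite !ffunE mulrDl scalerAl.
Qed.
Next Obligation.
by move=> v a x y; apply/ffunP => i; rewrite !ffunE mulrDr scalerAr.
Qed.
Next Obligation. by move=> v; apply/ffunP => i; rewrite ffunE mul1r. Qed.
Next Obligation. by move=> x y v; apply/ffunP => i; rewrite !ffunE mulrA. Qed.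
Next Obligation.
by move=> x v xN /powerP vN; apply/powerP => i; rewrite ffunE NM.
Qed.
Next Obligation.
move=> h a x y; rewrite scaler_sumr -big_split; apply: eq_bigr => i _ /=.
by rewrite !ffunE mulrDl scalerAl.
Qed.
Next Obligation.
move=> h a x y; rewrite scaler_sumr -big_split; apply: eq_bigr => i _ /=.
by rewrite !ffunE mulrDr scalerAr.
Qed.
Next Obligation.
by move=> x v h; rewrite mulr_sumr; apply: eq_bigr => i _; rewrite ffunE mulrA.
Qed.
Next Obligation.
by move=> v h /powerP vN /powerP hY; apply: memv_suml => i _; apply: NY.
Qed.
Next Obligation.
move=> h /powerP hY h0; apply/ffunP => i; rewrite ffunE -[RHS](h0 (unit_vec i)).
  rewrite (bigD1 i) //= ffunE eqxx mul1r big1 ?addr0 // => j /negPf ji.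
  by rewrite ffunE ji mul0r.
exact: unit_vec_power.
Qed.

(** D, E and F are matrices of operators on A. In the application they come from the
    regular representation of a Hopf algebra composed with comultiplication,
    D_jk x = rho_jk(x1) x2, and similarly with the inverse antipode (for E) or its
    square (for F) applied to x1. Through D the algebra N acts on N^n by the
    diagonal action on A ⊗ N; E is the inverse matrix of D, so it carries this
    action to the entrywise one. [EM] reflects that the antipode reverses products. *)
Variables D E F : 'I_n -> 'I_n -> A -> A.
Hypothesis Dlin : forall j k, linear (D j k).
Hypothesis Elin : forall j k, linear (E j k).
Hypothesis Flin : forall j k, linear (F j k).
Hypothesis DN : forall j k x, x \in N -> D j k x \in N.
Hypothesis EN : forall j k x, x \in N -> E j k x \in N.
Hypothesis EY : forall j k x, x \in Y -> E j k x \in Y.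
Hypothesis EM : forall j k x y, E j k (x * y) = \sum_l E l k x * E j l y.
Hypothesis DE : forall j k x, \sum_l D j l (E l k x) = (j == k)%:R *: x.
Hypothesis ED : forall j k x, \sum_l E j l (D l k x) = (j == k)%:R *: x.
Hypothesis FE : forall j k x, \sum_l F l k (E j l x) = (j == k)%:R *: x.
Hypothesis Y_neq0 : Y != 0%VS.
Hypothesis D_stable : forall I, lideal I ->
  (forall j k x, x \in I -> D j k x \in I) -> I = 0%VS \/ rann I = 0%VS.

Lemma lin_sum (f : A -> A) (s : 'I_n -> A) :
  linear f -> f (\sum_i s i) = \sum_i f (s i).
Proof.
move=> /lfun_of_linear[g gE]; rewrite -gE linear_sum.
by apply: eq_bigr => l _; apply: gE.
Qed.

Lemma twist_injective (G G' : 'I_n -> 'I_n -> A -> A) (f : An) :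
    (forall j k, linear (G' j k)) ->
    (forall j k x, \sum_l G' j l (G l k x) = (j == k)%:R *: x) ->
  [ffun j => \sum_k G' j k ([ffun k => \sum_l G k l (f l)] k)] = f.
Proof.
move=> G'lin G'G; apply/ffunP => j; rewrite ffunE.
under eq_bigr do rewrite ffunE lin_sum //.
rewrite exchange_big (bigD1 j) //= G'G eqxx scale1r big1 ?addr0 // => l /negPf lj.
by rewrite G'G eq_sym lj scale0r.
Qed.

Lemma twist_lfun (G : 'I_n -> 'I_n -> A -> A) :
    (forall j k, linear (G j k)) ->
  exists g : 'Hom(An, An), forall f, g f = [ffun j => \sum_k G j k (f k)].
Proof.
move=> Glin; suff /lfun_of_linear[g gE] :
    linear (fun f : An => [ffun j => \sum_k G j k (f k)] : An) by exists g.
move=> a u v; apply/ffunP => j; rewrite !ffunE scaler_sumr -big_split.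
by apply: eq_bigr => k _; rewrite !ffunE Glin.
Qed.

Lemma dim_limg_cancel (g g' : 'Hom(An, An)) U : cancel g g' -> \dim (g @: U) = \dim U.
Proof.
move=> gK; apply: limg_dim_eq; apply/eqP; rewrite -subv0; apply/subvP => f.
by rewrite memv_cap memv_ker memv0 => /andP[_ /eqP gf0]; rewrite -[f]gK gf0 linear0.
Qed.

(** The twist by E intertwines the diagonal action, given by D, with the action on
    each entry. *)
Lemma twist_act x (f : An) i :
  \sum_j E i j (\sum_k D j k x * f k) = x * \sum_k E i k (f k).
Proof.
under eq_bigr do rewrite lin_sum //.
rewrite exchange_big mulr_sumr; apply: eq_bigr => k _ /=.
under eq_bigr do rewrite EM.
rewrite exchange_big (bigD1 k) //= -mulr_suml ED eqxx scale1r.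
rewrite big1 ?addr0 // => l /negPf lk.
by rewrite -mulr_suml ED lk scale0r mul0r.
Qed.

(** Twisting vectors of N^n by E and vectors of Y^n by the transpose of E turns the
    pairing into sums of E applied to products of entries; it therefore vanishes on
    I^n and (rann I)^n. *)
Lemma twist_pairing (f y : An) :
  \sum_i (\sum_k E i k (f k)) * (\sum_j E j i (y j)) =
  \sum_j \sum_k E j k (f k * y j).
Proof.
under eq_bigr do rewrite mulr_sumr.
rewrite exchange_big; apply: eq_bigr => j _ /=.
under eq_bigr do rewrite mulr_suml.
rewrite exchange_big; apply: eq_bigr => k _ /=.
by rewrite EM.
Qed.

(** Let I be the smallest tight left ideal. The twist W of I^n corresponds to the
    submodule A ⊗ I of A ⊗ N with diagonal action. The twist of (rann I)^n is
    orthogonal to W and has dimension n dim (rann I), so W is tight because I is.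
    The colon ideals of W at the unit vectors are then tight, hence contain I, and
    undoing the twist this says that I is stable under D. *)
Lemma zero_tight : exists c p, [/\ (0 < c)%N,
  forall U, lideal U -> (c * \dim (rann U) + p * \dim U <= p * \dim N)%N &
  tight c p regular_pairing 0].
Proof.
have [c [p [c0 p0 bound [U0 [U0sub tU0 U0N]]]]] := exists_extremal_ratio Y_neq0.
exists c, p; split=> //.
have [|I [Isub tI Imin]] := tight_min c0 bound; first by exists U0.
have IN : I != N.
  apply: contra U0N => /eqP IN; rewrite eqEsubv; apply/andP; split; first by case: U0sub.
  by rewrite -IN Imin.
have [IleN Iact] := Isub.
suff /(D_stable Isub)[<- // | rI0] : forall j k x, x \in I -> D j k x \in I.
  move: tI; rewrite /tight /= rI0 dimv0 muln0 add0n leq_pmul2l // => leNI.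
  by case/negP: IN; rewrite eqEdim IleN.
have [e eE] := twist_lfun Elin; have [d dE] := twist_lfun Dlin.
have eK : cancel e d.
  by move=> f; rewrite eE dE; apply: (twist_injective _ Dlin DE).
pose W := (e @: power I)%VS.
have Wsub : submodule power_pairing W.
  split=> [|x _ xN /memv_imgP[f /powerP fI ->]].
    apply/subvP => _ /memv_imgP[f /powerP fI ->]; apply/powerP => i; rewrite eE ffunE.
    by apply: memv_suml => k _; rewrite EN // (subvP IleN).
  apply/memv_imgP; exists [ffun j => \sum_k D j k x * f k].
    by apply/powerP => j; rewrite ffunE memv_suml // => k _; rewrite Iact ?DN.
  rewrite !eE /=; apply/ffunP => i; rewrite !ffunE -twist_act.
  by apply: eq_bigr => j _; rewrite ffunE.
have leW : (n * \dim (rann I) <= \dim (orth power_pairing W))%N.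
  have [g gE] := twist_lfun (fun k j => Elin j k).
  have [h hE] := twist_lfun (fun k j => Flin j k).
  have gK : cancel g h.
    move=> f; rewrite gE hE.
    apply: (@twist_injective (fun k j => E j k) (fun j k => F k j)) => // j k x.
    by rewrite FE eq_sym.
  rewrite -dim_power -(dim_limg_cancel _ gK); apply: dimvS.
  apply/subvP => _ /memv_imgP[y /powerP yI ->]; apply/orthP; split.
    apply/powerP => k; rewrite gE ffunE memv_suml // => j _; apply: EY.
    by have /orthP[] := yI j.
  move=> _ /memv_imgP[f /powerP fI ->]; rewrite gE eE /=.
  under eq_bigr do rewrite !ffunE.
  rewrite twist_pairing big1 // => j _; rewrite big1 // => k _.
  have /orthP[_ /(_ _ (fI k)) /= ->] := yI j.
  by rewrite (linear_fun0 (Elin j k)).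
have tW : tight c p power_pairing W.
  rewrite /tight /= (dim_limg_cancel _ eK) !dim_power.
  have := leq_mul (leqnn n) tI; have := leq_mul (leqnn c) leW.
  by rewrite /= mulnDr; lia.
move=> j k x xI.
have [tcol _] := tight_colon c0 bound Wsub (unit_vec_power k) tW.
have /Imin/(_ tcol)/subvP/(_ x xI)/colonP[_] := colon_lideal (unit_vec k) Wsub.
case/memv_imgP=> f /powerP fI /(congr1 d); rewrite eK => /ffunP/(_ j).
rewrite dE ffunE => Dx; have := fI j; rewrite -Dx (bigD1 k) //= !ffunE eqxx mulr1.
rewrite big1 ?addr0 // => l /negPf lk; rewrite !ffunE lk mulr0.
by rewrite (linear_fun0 (Dlin j l)).
Qed.

(** Ratios of dimensions are constant, and Y is injective relative to principal left
    ideals: if every x in N killing v kills y, then v |-> y extends to N. *)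
Theorem annihilator_duality :
  (forall U, lideal U ->
     (\dim (rann U) * \dim N = \dim Y * (\dim N - \dim U))%N) /\
  (forall v y, v \in N -> y \in Y ->
     (forall x, x \in N -> x * v = 0 -> x * y = 0) ->
     exists2 a, a \in Y & v * a = y).
Proof.
have [c [p [c0 bound t0]]] := zero_tight; have sub0 := zero_lideal.
split=> [U Usub|v y vN yY vy]; last first.
  have [|a /orthP[aY _] <-] := (tight_colon c0 bound sub0 vN t0).2 y.
    by apply/orthP; split=> // x /colonP[xN]; rewrite memv0 => /eqP; apply: vy.
  by exists a.
have tU := tight_superset c0 bound sub0 Usub (sub0v U) t0.
have bU := bound _ Usub; have b0 := bound _ sub0.
move: tU t0 bU b0; rewrite /tight /= rann0 dimv0 muln0 !addn0 => tU t0 bU b0.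
apply/eqP; rewrite -(eqn_pmul2l c0); apply/eqP.
(* tightness of 0 identifies the extremal ratio as dim Y / dim N *)
have cY : (c * \dim Y = p * \dim N)%N by lia.
rewrite [RHS]mulnA cY mulnBr.
have /(congr1 (muln^~ (\dim N))) : (c * \dim (rann U) + p * \dim U = p * \dim N)%N by lia.
by rewrite mulnDl; lia.
Qed.

End Power.

End Pairings.

(** * Calculus with the comultiplication *)

Section Sweedler.
Variables (K : fieldType) (A : hopfAlgType K).

Lemma tlift_morph (U V W Z : lmodType K) (g : W -> Z) (f : U -> V -> W) t :
  linear g -> g (tlift f t) = tlift (fun a b => g (f a b)) t.
Proof.
move=> glin; pose gl : {linear W -> Z} := HB.pack g (GRing.isLinear.Build K W Z *:%R g glin).
by rewrite -[g]/(gl : W -> Z) linear_sum.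
Qed.

Lemma eq_tlift (U V W : lmodType K) (f g : U -> V -> W) t :
  (forall a b, f a b = g a b) -> tlift f t = tlift g t.
Proof. by move=> fg; apply: eq_bigr. Qed.

Definition trilinear (W : lmodType K) (f : A -> A -> A -> W) : Prop :=
  [/\ forall b c, linear (fun a => f a b c), forall a c, linear (fun b => f a b c) &
      forall a b, linear (f a b)].

(** Coassociativity in the form used by Sweedler calculus: the two ways of splitting
    x in three agree under any trilinear map. *)
Lemma coassoc (W : lmodType K) (f : A -> A -> A -> W) (x : A) : trilinear f ->
  tlift (fun a b => tlift (fun u v => f u v b) (comul a)) (comul x) =
  tlift (fun a b => tlift (fun u v => f a u v) (comul b)) (comul x).
Proof.
case=> f1 f2 f3.
have fb a : bilinear_for *:%R *:%R (f a) by split=> [c|b]; [apply: f2 | apply: f3].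
have Gb : bilinear_for *:%R *:%R (fun a t => tlift (f a) t).
  split=> [t a u v|a]; last exact: tlift_linear.
  rewrite /= /tlift /tsum scaler_sumr -big_split; apply: eq_bigr => p _ /=.
  exact: f1.
have tb (w : A) : bilinear_for *:%R *:%R (fun u v : A => u ⊗ (v ⊗ w)).
  split=> [v|u] a x1 x2 /=; first by rewrite ((tpure_bilinear _ _).1 _ a).
  by rewrite ((tpure_bilinear _ _).1 _ a) ((tpure_bilinear _ _).2 _ a).
have ab : bilinear_for *:%R *:%R (fun (t : tensor A A) (w : A) =>
    tlift (fun u v => u ⊗ (v ⊗ w)) t).
  split=> [w|t a u v]; first exact: tlift_linear.
  rewrite /= /tlift /tsum scaler_sumr -big_split; apply: eq_bigr => p _ /=.
  by rewrite ((tpure_bilinear _ _).2 _ a) ((tpure_bilinear _ _).2 _ a).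
have := congr1 (tlift (fun a t => tlift (f a) t)) (comulA x).
rewrite /tmap /tassoc (tlift_morph _ _ (tlift_linear ab)).
rewrite !(tlift_morph _ _ (tlift_linear Gb)).
move=> eq_x; transitivity (tlift (fun a b => tlift (fun a t => tlift [eta f a] t)
   (tlift (fun t w => tlift (fun u v => u ⊗ (v ⊗ w)) t) (comul a ⊗ id b))) (comul x)).
  apply: eq_tlift => a b; rewrite (tlift_pure ab) (tlift_morph _ _ (tlift_linear Gb)).
  by apply: eq_tlift => u v; rewrite (tlift_pure Gb) (tlift_pure (fb u)).
by rewrite eq_x; apply: eq_tlift => a b; rewrite (tlift_pure Gb).
Qed.

Lemma comulM (W : lmodType K) (f : A -> A -> W) x y : bilinear_for *:%R *:%R f ->
  tlift f (comul (x * y)) =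
  tlift (fun a b => tlift (fun u v => f (a * u) (b * v)) (comul y)) (comul x).
Proof.
move=> fb; rewrite rmorphM /= /GRing.mul /= /tmul (tlift_morph _ _ (tlift_linear fb)).
apply: eq_tlift => a b; rewrite (tlift_morph _ _ (tlift_linear fb)).
by apply: eq_tlift => u v; rewrite (tlift_pure fb).
Qed.

End Sweedler.

Section Antipode.
Variables (K : fieldType) (A : hopfAlgType K).

Lemma comul_counitlE (W : lmodType K) (g : A -> W) x : linear g ->
  tlift (fun a b => counit a *: g b) (comul x) = g x.
Proof.
move=> glin; rewrite -[in RHS](comul_counitl x) (tlift_morph _ _ glin).
by apply: eq_tlift => a b; rewrite (scalable_linear glin).
Qed.

Lemma comul_counitrE (W : lmodType K) (g : A -> W) x : linear g ->
  tlift (fun a b => counit b *: g a) (comul x) = g x.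
Proof.
move=> glin; rewrite -[in RHS](comul_counitr x) (tlift_morph _ _ glin).
by apply: eq_tlift => a b; rewrite (scalable_linear glin).
Qed.

Lemma mulr_linear (a : A) : linear (fun x : A => x * a).
Proof. by move=> c x y; rewrite mulrDl scalerAl. Qed.

Lemma mull_linear (a : A) : linear (fun x : A => a * x).
Proof. by move=> c x y; rewrite mulrDr scalerAr. Qed.

Lemma comp_linear (U V W : lmodType K) (g : V -> W) (f : U -> V) :
  linear g -> linear f -> linear (fun x => g (f x)).
Proof. by move=> glin flin a x y; rewrite flin glin. Qed.

(** Associativity of convolution: compute S(x1) x2 h(x3) in two ways. *)
Lemma convolution_antipode (h : A -> A) (c : A) : linear h ->
  (forall x, tlift (fun a b => a * h b) (comul x) = counit x *: c) ->
  forall x, h x = antipode x * c.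
Proof.
move=> hlin hc x.
have tri : trilinear (fun a b d => antipode a * b * h d).
  split=> [b d|a d|a b].
  - by move=> k u v /=; rewrite antipode_linear !mulrDl !scalerAl.
  - by move=> k u v /=; rewrite mulrDr -scalerAr !mulrDl !scalerAl.
  - by move=> k u v /=; rewrite hlin mulrDr scalerAr.
have := coassoc x tri.
under eq_tlift => a b.
  rewrite -(tlift_morph (g := fun z => z * h b)); last exact: mulr_linear.
  rewrite antipodel -scalerAl mul1r; over.
rewrite (comul_counitlE _ hlin) => ->.
under eq_tlift => a b.
  under eq_tlift do rewrite -mulrA.
  rewrite -(tlift_morph (g := fun z => antipode a * z)); last exact: mull_linear.
  rewrite hc -scalerAr; over.
apply: (comul_counitrE (g := fun z => antipode z * c)).
by move=> k u v /=; rewrite antipode_linear mulrDl scalerAl.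
Qed.

(** Two applications of [convolution_antipode]: the sum over y of y1 S(u y2) is
    counit(y) S(u), because as a function of u it is a right convolution inverse of
    the identity up to counit(y); and then y |-> S(x y) is determined in turn. *)
Lemma antipodeM (x y : A) : antipode (x * y) = antipode y * antipode x.
Proof.
have lin_y (u : A) : linear (fun y => antipode (u * y)).
  by move=> k a b /=; rewrite mulrDr -scalerAr antipode_linear.
have conv (u v : A) : tlift (fun a b => a * antipode (u * b)) (comul v) = counit v *: antipode u.
  pose h u := tlift (fun a b => a * antipode (u * b)) (comul v).
  have hlin : linear h.
    move=> k a b /=; rewrite /h /tlift /tsum scaler_sumr -big_split; apply: eq_bigr => p _ /=.
    by rewrite mulrDl -scalerAl antipode_linear mulrDr -scalerAr.
  rewrite -[LHS]/(h u) (convolution_antipode (c := (counit v)%:A) hlin).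
    by rewrite -scalerAr mulr1.
  move=> w; rewrite scalerA -rmorphM /= -antipoder comulM; last first.
    split=> [b|a] k d e /=; first by rewrite mulrDl scalerAl.
    by rewrite antipode_linear mulrDr scalerAr.
  apply: eq_tlift => a b; rewrite /h (tlift_morph (g := fun z => a * z)); last exact: mull_linear.
  by apply: eq_tlift => d e; rewrite mulrA.
apply: (convolution_antipode (h := fun y => antipode (x * y))) => //.
Qed.

Variable S' : A -> A.
Hypothesis antipodeK : cancel antipode S'.
Hypothesis S'K : cancel S' antipode.

Lemma inv_antipode_linear : linear S'.
Proof.
by move=> a x y /=; apply: (can_inj antipodeK); rewrite antipode_linear !S'K.
Qed.

Lemma inv_antipodeM x y : S' (x * y) = S' y * S' x.
Proof. by apply: (can_inj antipodeK); rewrite antipodeM !S'K. Qed.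

Lemma antipode1 : antipode 1 = 1 :> A.
Proof.
by rewrite -[LHS]mulr1 -[X in _ * X]S'K -antipodeM mulr1 S'K.
Qed.

Lemma inv_antipode1 : S' 1 = 1.
Proof. by rewrite -{1}antipode1 antipodeK. Qed.

Lemma inv_antipodel x : tlift (fun a b => S' b * a) (comul x) = (counit x)%:A.
Proof.
apply: (can_inj antipodeK); rewrite (tlift_morph (g := antipode)); last exact: antipode_linear.
rewrite linearZ /= antipode1 -antipodel; apply: eq_tlift => a b.
by rewrite antipodeM S'K.
Qed.

Lemma inv_antipoder x : tlift (fun a b => b * S' a) (comul x) = (counit x)%:A.
Proof.
apply: (can_inj antipodeK); rewrite (tlift_morph (g := antipode)); last exact: antipode_linear.
rewrite linearZ /= antipode1 -antipoder; apply: eq_tlift => a b.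
by rewrite antipodeM S'K.
Qed.

End Antipode.

Section Hit.
Variables (K : fieldType) (A : hopfAlgType K).

(** The action of the functional f on A that eats the first leg of the coproduct;
    left coideals are the subspaces stable under all of these. *)
Definition hit (f : A -> K) (x : A) : A := tlift (fun a b => f a *: b) (comul x).

Lemma hit_bilinear (f : A -> K) : scalar f -> bilinear_for *:%R *:%R (fun a b : A => f a *: b).
Proof.
move=> flin; split=> [b|a] k u v /=; first by rewrite flin scalerDl scalerA.
by rewrite scalerDr !scalerA mulrC.
Qed.

Lemma hit_linear (f : A -> K) : scalar f -> linear (hit f).
Proof.
move=> flin a x y; rewrite /hit comul_linear.
by rewrite (tlift_linear (hit_bilinear flin)).
Qed.

Lemma hit_counit x : hit counit x = x.
Proof. exact: comul_counitl. Qed.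

Lemma hitM n (f : A -> K) (g h : 'I_n -> A -> K) x y : scalar f ->
    (forall a b, f (a * b) = \sum_l g l a * h l b) ->
  hit f (x * y) = \sum_l hit (g l) x * hit (h l) y.
Proof.
move=> flin fM; rewrite /hit (comulM _ _ (hit_bilinear flin)).
rewrite [RHS](eq_bigr (fun l => tlift (fun a b =>
    tlift (fun u v => (g l a * h l u) *: (b * v)) (comul y)) (comul x))); last first.
  move=> l _; rewrite (tlift_morph (g := fun z => z * hit (h l) y)); last exact: mulr_linear.
  apply: eq_tlift => a b; rewrite (tlift_morph (g := fun z => (g l a *: b) * z)); last exact: mull_linear.
  by apply: eq_tlift => u v; rewrite -scalerAl -scalerAr scalerA.
rewrite /tlift /tsum [RHS]exchange_big; apply: eq_bigr => p _ /=.
rewrite [RHS]exchange_big; apply: eq_bigr => q _ /=.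
by rewrite fM scaler_suml.
Qed.

(** Composition of such actions is convolution of functionals, in reverse order. *)
Lemma hit_hit (f g : A -> K) x : scalar f -> scalar g ->
  hit f (hit g x) = hit (fun z => tlift (fun a b => f b *: (g a : K^o)) (comul z)) x.
Proof.
move=> flin glin.
have tri : trilinear (fun a u v : A => (g a * f u) *: v).
  split=> [b c|a c|a b] k u v.
  - by rewrite glin mulrDl scalerDl -mulrA scalerA.
  - by rewrite flin mulrDr scalerDl mulrCA scalerA.
  - by rewrite scalerDr !scalerA mulrC.
rewrite [RHS]/hit.
rewrite (tlift_morph (g := hit f)); last exact: hit_linear.
transitivity (tlift (fun a b => tlift (fun u v => (g a * f u) *: v) (comul b)) (comul x)).
  apply: eq_tlift => a b; rewrite (scalable_linear (hit_linear flin)).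
  rewrite /=;  rewrite /hit /tlift /tsum scaler_sumr; apply: eq_bigr => p _ /=.
  by rewrite scalerA.
rewrite -(coassoc x tri); apply: eq_tlift => a b.
rewrite /tlift /tsum scaler_suml; apply: eq_bigr => p _ /=.
by rewrite /GRing.scale /= mulrC.
Qed.

Lemma hit_sum_hit n (f g : 'I_n -> A -> K) c x :
    (forall l, scalar (f l)) -> (forall l, scalar (g l)) ->
    (forall z, \sum_l tlift (fun a b => f l b *: (g l a : K^o)) (comul z) = c * counit z) ->
  \sum_l hit (f l) (hit (g l) x) = c *: x.
Proof.
move=> flin glin fg; under eq_bigr do rewrite hit_hit //.
rewrite /hit /tlift /tsum exchange_big /=.
under eq_bigr do rewrite -scaler_suml.
rewrite -[in RHS](hit_counit x) /hit /tlift /tsum scaler_sumr.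
apply: eq_bigr => p _; rewrite scalerA -fg; congr (_ *: _).
Qed.

End Hit.

(** * Integrals and finite dimension *)

Section Integral.
Variables (K : fieldType) (A : hopfAlgType K).

Definition left_integral (L : A) := forall a, a * L = counit a *: L.

(** Some component x of 1 in a simple summand has nonzero counit. The elements of
    counit 0 in that summand form a proper left subideal, hence vanish; in
    particular a x - counit(a) x = 0. *)
Lemma semisimple_integral : semisimple_ring A ->
  exists2 L : A, left_integral L & counit L = 1.
Proof.
case=> n [I [Isimple Isum]].
have [x [[xI x1] _]] := Isum 1.
have [i xi] : exists i, counit (x i) != 0.
  apply: contrapT => /forallNP xi.
  have : counit (1 : A) = 0.
    rewrite x1 linear_sum big1 // => i _; apply/eqP; apply: contrapT => /negP.
    exact: xi.
  by rewrite rmorph1 => /eqP; rewrite oner_eq0.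
have [[I0 ID IM] _ Imin] := Isimple i.
pose J := [set y | I i y /\ counit y = 0]%classic.
have Jideal : left_ideal J.
  split=> [|y z [yI y0] [zI z0]|a y [yI y0]].
  - by split; [exact: I0 | rewrite linear0].
  - by split; [exact: ID | rewrite linearD /= y0 z0 addr0].
  - by split; [exact: IM | rewrite rmorphM /= y0 mulr0].
have [|J0|JI] := Imin J Jideal; first by move=> y [].
  have intx a : a * x i = counit a *: x i.
    apply/eqP; rewrite -subr_eq0; apply/eqP.
    have : J (a * x i - counit a *: x i).
      split; last by rewrite linearB linearZ /= rmorphM subrr.
      rewrite -[_ *: x i]mulr_algl -mulrBl; exact: IM.
    by rewrite J0.
  exists ((counit (x i))^-1 *: x i); last by rewrite linearZ /= mulVf.
  by move=> a; rewrite -scalerAr intx scalerA mulrC -scalerA.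
by have : J (x i); [rewrite JI; apply: xI | case=> _ x0; rewrite x0 eqxx in xi].
Qed.

(** Split a in three and compute S(a1) a2 L1 ⊗ a3 L2 in two ways: the first two
    factors cancel, or the last two are absorbed by the integral. *)
Lemma integral_hit (L : A) (c : A -> K) a : left_integral L -> scalar c ->
  a * hit c L = hit (fun u => c (antipode a * u)) L.
Proof.
move=> intL clin.
have cl (u : A) : scalar (fun v => c (u * v)).
  by move=> k v w; rewrite mulrDr -scalerAr clin.
pose g (d z : A) := tlift (fun l m => c (z * l) *: (d * m)) (comul L).
have glin d : linear (g d).
  move=> k u v; rewrite /g /tlift /tsum scaler_sumr -big_split.
  apply: eq_bigr => p _ /=.
  by rewrite mulrDl -scalerAl clin scalerDl scalerA.
have tri : trilinear (fun a b d => g d (antipode a * b)).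
  split=> [b d|u d|u b] k v w /=.
  - by rewrite antipode_linear mulrDl -scalerAl glin.
  - by rewrite mulrDr -scalerAr glin.
  rewrite /g /tlift /tsum scaler_sumr -big_split; apply: eq_bigr => p _ /=.
  by rewrite mulrDl -scalerAl scalerDr !scalerA mulrC.
have := coassoc a tri.
under eq_tlift => u b.
  rewrite -(tlift_morph _ _ (glin b)) antipodel (scalable_linear (glin b)) /=.
  over.
have g1 b : g b 1 = b * hit c L.
  rewrite /hit (tlift_morph (g := fun z => b * z)); last exact: mull_linear.
  by apply: eq_tlift => u v; rewrite mul1r scalerAr.
under eq_tlift do rewrite g1.
rewrite (comul_counitlE _ (mulr_linear (hit c L))) => ->.
under eq_tlift => u b.
  have -> : tlift (fun v w => g w (antipode u * v)) (comul b) =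
      counit b *: hit (fun v => c (antipode u * v)) L.
    rewrite -(scalable_linear (hit_linear (cl (antipode u)))) /= -intL /hit.
    rewrite comulM; last exact: hit_bilinear (cl _).
    by apply: eq_tlift => v w; apply: eq_tlift => l m; rewrite mulrA.
  over.
apply: (comul_counitrE (g := fun u => hit (fun v => c (antipode u * v)) L)).
move=> k u v; rewrite /hit /tlift /tsum scaler_sumr -big_split.
apply: eq_bigr => p _ /=.
by rewrite antipode_linear mulrDl -scalerAl clin scalerDl scalerA.
Qed.

Lemma tpureZr k (u v : A) : u ⊗ (k *: v) = k *: (u ⊗ v).
Proof. exact: (scalable_linear ((tpure_bilinear A A).2 u)). Qed.

Lemma tlift_sumr (W : lmodType K) (f : A -> A -> W) n (b y : 'I_n -> A) :
  bilinear_for *:%R *:%R f -> tlift f (\sum_i b i ⊗ y i) = \sum_i f (b i) (y i).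
Proof.
move=> fb; pose F : {linear tensor A A -> W} :=
  HB.pack (tlift f) (GRing.isLinear.Build K _ W *:%R _ (tlift_linear fb)).
rewrite -[LHS]/(F _) linear_sum; apply: eq_bigr => i _; exact: tlift_pure.
Qed.

Lemma tensor_dual n (b : 'I_n -> A) (c : 'I_n -> A -> K) (t : tensor A A) :
    (forall v, v \in [seq p.1 | p <- repr t] -> v = \sum_i c i v *: b i) ->
  t = \sum_i b i ⊗ tlift (fun u v => c i u *: v) t.
Proof.
move=> cb; rewrite {1}[t]tensor_sumE /tlift /tsum.
rewrite big_seq (eq_bigr (fun p => \sum_i b i ⊗ (c i p.1 *: p.2))); last first.
  move=> p pt; rewrite {1}(cb p.1) ?map_f //.
  pose f u : tensor A A := u ⊗ p.2.
  have flin : linear f := (tpure_bilinear _ _).1 p.2.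
  pose fl : {linear A -> tensor A A} := HB.pack f (GRing.isLinear.Build K A _ *:%R f flin).
  rewrite -[LHS]/(fl _) linear_sum; apply: eq_bigr => i _.
  by rewrite linearZ /= /f tpureZr.
rewrite -big_seq exchange_big; apply: eq_bigr => i _ /=.
have flin : linear (tpure (b i) : A -> tensor A A) := (tpure_bilinear _ _).2 (b i).
pose fl : {linear A -> tensor A A} := HB.pack (tpure (b i) : A -> tensor A A) (GRing.isLinear.Build K A _ *:%R _ flin).
by rewrite -[RHS]/(fl _) linear_sum.
Qed.

(** Write comul L as a sum of b_i ⊗ y_i with b independent. By [integral_hit] the
    span of the y_i is a left ideal; it contains the sum of S(b_i) y_i, which is 1. *)
Lemma integral_finite_dimensional (L : A) : left_integral L -> counit L = 1 ->
  exists n (b : 'I_n -> A) (c : 'I_n -> A -> K),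
    [/\ forall i, scalar (c i), forall i j, c i (b j) = (i == j)%:R &
        forall v, v = \sum_i c i v *: b i].
Proof.
move=> intL L1.
have [n [b [c [clin cb bc]]]] := dual_family [seq p.1 | p <- repr (comul L)].
have LE := tensor_dual bc.
pose y i := hit (c i) L.
have yE a i : a * y i = \sum_j c i (antipode a * b j) *: y j.
  rewrite integral_hit // {1}/hit LE tlift_sumr //.
  by apply: hit_bilinear => k u v; rewrite mulrDr -scalerAr clin.
have oneE : 1 = \sum_i antipode (b i) * y i.
  rewrite -[LHS]scale1r -L1 -antipodel LE tlift_sumr //.
  split=> [v|u] k w z /=; first by rewrite antipode_linear mulrDl scalerAl.
  by rewrite mulrDr scalerAr.
(* the y_i span A; replace them by a basis of their span *)
have [m [d [f [flin fd df]]]] := dual_family (codom y).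
exists m, d, f; split=> // v.
have [k ->] : exists k : 'I_n -> K, v = \sum_j k j *: y j.
  exists (fun j => \sum_i c i (antipode (v * antipode (b i)) * b j)).
  rewrite -[LHS]mulr1 oneE mulr_sumr.
  under eq_bigr do rewrite mulrA yE.
  rewrite exchange_big; apply: eq_bigr => j _ /=.
  by rewrite scaler_suml.
under [RHS]eq_bigr do rewrite scalar_sum // scaler_suml.
rewrite exchange_big; apply: eq_bigr => j _ /=.
rewrite {1}(df (y j)) ?codom_f // scaler_sumr.
by apply: eq_bigr => i _; rewrite scalerA.
Qed.

End Integral.

(** * The integral of a left coideal subalgebra *)

Section CoidealElements.
Variables (K : fieldType) (A : hopfAlgType K) (N : set A).
Hypothesis coN : left_coideal_subalgebra N.

Lemma coideal1 : N 1.
Proof. by case: coN => [[N1 _ _] _]; move: N1; rewrite !inE. Qed.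

Lemma coidealM x y : N x -> N y -> N (x * y).
Proof.
case: coN => [[_ _ NM] _] xN yN; have := NM x y.
by rewrite !inE => /(_ xN yN).
Qed.

Lemma coidealP a x y : N x -> N y -> N (a *: x + y).
Proof.
case: coN => [[_ NP _] _] xN yN; have := NP a x y.
by rewrite !inE => /(_ xN yN).
Qed.

Lemma coideal0 : N 0.
Proof. by have := coidealP (-1) coideal1 coideal1; rewrite scaleN1r addNr. Qed.

Lemma coidealB x y : N x -> N y -> N (x - y).
Proof. by move=> xN yN; rewrite addrC -scaleN1r; apply: coidealP. Qed.

Lemma coidealZ a x : N x -> N (a *: x).
Proof. by move=> xN; rewrite -[_ *: x]addr0; apply: coidealP => //; exact: coideal0. Qed.

(** Since comul x lies in A ⊗ N, bilinear maps that agree when the second argument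
    is in N agree on it. *)
Lemma coideal_tlift (W : lmodType K) (f g : A -> A -> W) x :
    bilinear_for *:%R *:%R f -> bilinear_for *:%R *:%R g ->
    (forall a b, N b -> f a b = g a b) -> N x ->
  tlift f (comul x) = tlift g (comul x).
Proof.
move=> fb gb fg /(coN.2)[s sN ->].
have lsum (h : A -> A -> W) : bilinear_for *:%R *:%R h ->
    tlift h (\sum_(p <- s) p.1 ⊗ p.2) = \sum_(p <- s) h p.1 p.2.
  move=> hb; elim: s {sN} => [|p s IHs]; first by rewrite !big_nil tlift_tzero.
  by rewrite !big_cons tlift_tadd // IHs tlift_pure.
by rewrite !lsum // big_seq [RHS]big_seq; apply: eq_bigr => p /sN; apply: fg.
Qed.

Lemma coideal_hit (f : A -> K) x : scalar f -> N x -> N (hit f x).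
Proof.
move=> flin /(coN.2)[s sN]; rewrite /hit => ->.
elim: s sN => [_|p s IHs sN].
  by rewrite big_nil (tlift_tzero (hit_bilinear flin)); exact: coideal0.
rewrite big_cons (tlift_tadd (hit_bilinear flin)) (tlift_pure (hit_bilinear flin)).
apply: coidealP; first by apply: sN; rewrite mem_head.
by apply: IHs => q qs; apply: sN; rewrite in_cons qs orbT.
Qed.

End CoidealElements.

Section CoidealSubalgebra.
Variables (K : fieldType) (A : hopfAlgType K).
Variables (S' : A -> A) (antipodeK : cancel antipode S') (S'K : cancel S' antipode).
Variables (n : nat) (b : 'I_n -> A) (c : 'I_n -> A -> K).
Hypothesis clin : forall i, scalar (c i).
Hypothesis cb : forall i j, c i (b j) = (i == j)%:R.
Hypothesis bc : forall v, v = \sum_i c i v *: b i.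

Fact coord_axiom : Vector.axiom n A.
Proof.
exists (fun v => \row_i c i v).
  by move=> a u v; apply/rowP => i; rewrite !mxE clin.
exists (fun r : 'rV_n => \sum_i r 0 i *: b i) => [v|r].
  by rewrite [RHS]bc; apply: eq_bigr => i _; rewrite mxE.
apply/rowP => i; rewrite mxE scalar_sum // (bigD1 i) //= cb eqxx mulr1.
by rewrite big1 ?addr0 // => j /negPf ji; rewrite cb eq_sym ji mulr0.
Qed.

Let vA : vectType K := HB.pack (HopfAlgebra.sort A) (Lmodule_hasFinDim.Build K (HopfAlgebra.sort A) coord_axiom).
Let F : falgType K := HB.pack (HopfAlgebra.sort A) vA
  (Algebra_isFalgebra.Build K vA).

(** Matrix coefficients of the left regular representation in the basis b; below,
    the same with one or two inverse antipodes. *)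
Definition rho j k a := c j (a * b k).
Definition rho_inv j k a := c j (S' a * b k).
Definition rho_inv2 j k a := c j (S' (S' a) * b k).

Lemma coord_mul_scalar (X : A -> A) j k : linear X -> scalar (fun a => c j (X a * b k)).
Proof. by move=> Xlin a u v; rewrite Xlin mulrDl -scalerAl clin. Qed.

Lemma rho_scalar j k : scalar (rho j k).
Proof. by apply: (coord_mul_scalar (X := id)). Qed.

Lemma rho_inv_scalar j k : scalar (rho_inv j k).
Proof. by apply: coord_mul_scalar; exact: inv_antipode_linear. Qed.

Lemma rho_inv2_scalar j k : scalar (rho_inv2 j k).
Proof. by apply: coord_mul_scalar; apply: comp_linear; exact: inv_antipode_linear. Qed.

Lemma coord_mulmx x y j k : c j (x * y * b k) = \sum_l c j (x * b l) * c l (y * b k).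
Proof.
rewrite -mulrA {1}(bc (y * b k)) mulr_sumr.
under [in LHS]eq_bigr do rewrite -scalerAr.
by rewrite scalar_sum //; apply: eq_bigr => l _; rewrite mulrC.
Qed.

(** A product of operator matrices acts through the convolution of the corresponding
    matrix coefficients. When the underlying convolution is the counit, as for an
    antipode identity, the product is the identity matrix. *)
Lemma hit_matrix (f g : 'I_n -> A -> K) (Z : A -> A -> A) j k x :
    (forall l, scalar (f l)) -> (forall l, scalar (g l)) ->
    (forall u v, \sum_l f l v * g l u = c j (Z u v * b k)) ->
    (forall z, tlift Z (comul z) = (counit z)%:A) ->
  \sum_l hit (f l) (hit (g l) x) = (j == k)%:R *: x.
Proof.
move=> flin glin fg Zeps; apply: hit_sum_hit => // z.
rewrite /tlift /tsum exchange_big /=.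
transitivity (c j (tlift Z (comul z) * b k)).
  rewrite /tlift /tsum mulr_suml; under eq_bigr do rewrite fg.
  under [in RHS]eq_bigr do rewrite -[_ * b k]scale1r.
  by rewrite scalar_sum //; apply: eq_bigr => p _; rewrite mul1r.
by rewrite Zeps -scalerAl mul1r -[_ *: _]addr0 clin scalar0 // addr0 cb mulrC.
Qed.

Section Annihilators.
Variables (N : set A) (coN : left_coideal_subalgebra N).
Variables (Y : {vspace F}) (Y_neq0 : Y != 0%VS).

Let NN : {vspace F} := vspace_of (N : F -> Prop).

Lemma memNN (x : F) : x \in NN <-> N x.
Proof.
by apply: mem_vspace_of; [exact: coideal0 | exact: coidealP].
Qed.

Hypothesis NY : forall x y : F, x \in NN -> y \in Y -> x * y \in Y.
Hypothesis hitY : forall f (y : F), scalar f -> y \in Y -> (hit f y : F) \in Y.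

Fact NN1 : (1 : F) \in NN. Proof. by apply/memNN; exact: coideal1. Qed.
Fact NNM (x y : F) : x \in NN -> y \in NN -> x * y \in NN.
Proof. by move=> /memNN xN /memNN yN; apply/memNN; apply: coidealM. Qed.

Notation reg := (regular_pairing NN1 NNM NY).

Lemma comul_basis x : comul x = \sum_i b i ⊗ hit (c i) x.
Proof. exact: (tensor_dual (fun v _ => bc v)). Qed.

(** The coordinate functionals are combinations of the rho_jk, so comul I lies in
    A ⊗ I. If the counit vanishes on I, then
    x = x1 counit(x2) = 0 for x in I. Otherwise, S(x1) x2 = counit(x) shows that A I
    contains 1, so nothing but 0 is annihilated by I. *)
Lemma hit_stable_ideal (I : {vspace F}) : submodule reg I ->
    (forall j k (x : F), x \in I -> (hit (rho j k) x : F) \in I) ->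
  I = 0%VS \/ orth reg I = 0%VS.
Proof.
move=> [_ Iact] Ihit.
have Ic i (x : F) : x \in I -> (hit (c i) x : F) \in I.
  move=> xI; have -> : hit (c i) x = \sum_k c k 1 *: hit (rho i k) x.
    rewrite /hit /tlift /tsum.
    under [RHS]eq_bigr do rewrite scaler_sumr.
    rewrite exchange_big; apply: eq_bigr => p _ /=.
    rewrite -{1}[p.1]mulr1 {1}(bc 1) mulr_sumr.
    under [in LHS]eq_bigr do rewrite -scalerAr.
    by rewrite scalar_sum // scaler_suml; apply: eq_bigr => k _; rewrite scalerA.
  by apply: memv_suml => k _; rewrite memvZ ?Ihit.
case: (EM (exists2 x : F, x \in I & counit (x : A) != 0)) => [[x xI x0]|I0].
  right; apply/eqP; rewrite -subv0; apply/subvP => y /orthP[_ Iy].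
  have : counit (x : A) *: (y : A) = 0.
    rewrite -[RHS](mulr0 1) -[_ *: _]mulr_algl -antipodel comul_basis tlift_sumr.
      rewrite mulr_suml big1 ?mulr0 // => i _; rewrite -mulrA.
      by have /= -> := Iy _ (Ic i x xI); rewrite mulr0.
    split=> [v|u] k w z /=; first by rewrite antipode_linear mulrDl scalerAl.
    by rewrite mulrDr scalerAr.
  by move=> /eqP; rewrite scaler_eq0 (negPf x0) memv0.
left; apply/eqP; rewrite -subv0; apply/subvP => x xI; rewrite memv0.
rewrite -[x : A]comul_counitr comul_basis tlift_sumr; last first.
  split=> [v|u] k w z /=; first by rewrite scalerDr !scalerA mulrC.
  by rewrite linearP scalerDl scalerA.
rewrite big1 // => i _; have -> : counit (hit (c i) x) = 0; last by rewrite scale0r.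
by apply/eqP; apply: contrapT => /negP h0; apply: I0; exists (hit (c i) x); rewrite ?Ic.
Qed.

Definition augmentation : {vspace F} :=
  vspace_of (fun x : F => N x /\ counit (x : A) = 0).

Lemma augmentationP (x : F) : x \in augmentation <-> N x /\ counit (x : A) = 0.
Proof.
apply: mem_vspace_of => [|a u v [uN u0] [vN v0]].
  by split; [exact: coideal0 | exact: linear0].
by split; [exact: coidealP | rewrite linearP /= u0 v0 mulr0 addr0].
Qed.

Lemma augmentation_sub x : N x -> (x - (counit x)%:A : F) \in augmentation.
Proof.
move=> xN; apply/augmentationP; split.
  by apply: coidealB => //; apply: coidealZ => //; exact: coideal1.
by rewrite linearB linearZ /= rmorph1 mulr1 subrr.
Qed.

Lemma augmentation_ideal : submodule reg augmentation.
Proof.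
split=> [|x u xN /augmentationP[uN u0]].
  by apply/subvP => x /augmentationP[xN _]; apply/memNN.
apply/augmentationP; split; first by apply: coidealM => //; apply/memNN.
by rewrite rmorphM /= u0 mulr0.
Qed.

Lemma dim_augmentation : \dim NN = (\dim augmentation).+1.
Proof.
have : NN = (augmentation + <[1 : F]>)%VS.
  apply/vspaceP => x; apply/idP/idP => [/memNN xN|].
    rewrite -[x](subrK ((counit (x : A))%:A : F)); apply: memv_add.
      exact: augmentation_sub.
    by rewrite memvZ ?memv_line.
  case/memv_addP=> u /augmentationP[uN _] [_ /vlineP[k ->] ->].
  by apply/memNN; rewrite addrC; apply: coidealP => //; exact: coideal1.
move=> ->; rewrite dimv_disjoint_sum; first by rewrite dim_vline oner_neq0 addn1.
apply/eqP; rewrite -subv0; apply/subvP => x; rewrite memv_cap => /andP[].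
move=> /augmentationP[_ x0] /vlineP[k xk]; move: x0.
by rewrite xk linearZ /= rmorph1 mulr1 => ->; rewrite scale0r; apply: mem0v.
Qed.

Let hitN f (x : F) : scalar f -> x \in NN -> (hit f x : F) \in NN.
Proof. by move=> flin /memNN xN; apply/memNN; apply: coideal_hit. Qed.

Lemma coideal_duality :
  (forall U, submodule reg U ->
     (\dim (orth reg U) * \dim NN = \dim Y * (\dim NN - \dim U))%N) /\
  (forall v y : F, v \in NN -> y \in Y ->
     (forall x : F, x \in NN -> x * v = 0 -> x * y = 0) ->
     exists2 a : F, a \in Y & v * a = y).
Proof.
have := @annihilator_duality K F NN Y NN1 NNM NY n (fun j k => hit (rho j k))
  (fun j k => hit (rho_inv j k)) (fun j k => hit (rho_inv2 j k)).
apply.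
- by move=> j k; apply: (hit_linear (rho_scalar j k)).
- by move=> j k; apply: (hit_linear (rho_inv_scalar j k)).
- by move=> j k; apply: (hit_linear (rho_inv2_scalar j k)).
- by move=> j k x; apply: hitN; exact: rho_scalar.
- by move=> j k x; apply: hitN; exact: rho_inv_scalar.
- by move=> j k x; apply: hitY; exact: rho_inv_scalar.
- move=> j k x y; apply: hitM; first exact: rho_inv_scalar.
  move=> u v; rewrite /rho_inv (inv_antipodeM antipodeK S'K) coord_mulmx.
  by apply: eq_bigr => l _; rewrite mulrC.
- move=> j k x; apply: (hit_matrix (Z := fun u v => v * S' u)).
  + by move=> l; apply: rho_scalar.
  + by move=> l; apply: rho_inv_scalar.
  + by move=> u v; rewrite coord_mulmx.
  exact: (inv_antipoder antipodeK S'K).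
- move=> j k x; apply: (hit_matrix (Z := fun u v => S' v * u)).
  + by move=> l; apply: rho_inv_scalar.
  + by move=> l; apply: rho_scalar.
  + by move=> u v; rewrite coord_mulmx.
  exact: (inv_antipodel antipodeK S'K).
- move=> j k x; apply: (hit_matrix (Z := fun u v => S' u * S' (S' v))).
  + by move=> l; apply: rho_inv2_scalar.
  + by move=> l; apply: rho_inv_scalar.
  + by move=> u v; rewrite coord_mulmx; apply: eq_bigr => l _; rewrite mulrC.
  have S'lin := inv_antipode_linear antipodeK S'K.
  move=> z; under eq_tlift do rewrite -(inv_antipodeM antipodeK S'K).
  rewrite -(tlift_morph _ _ S'lin) (inv_antipodel antipodeK S'K).
  by rewrite (scalable_linear S'lin) (inv_antipode1 antipodeK S'K).
- exact: Y_neq0.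
exact: hit_stable_ideal.
Qed.

Lemma dim_annihilator_augmentation :
  (\dim (orth reg augmentation) * \dim NN = \dim Y)%N.
Proof.
rewrite coideal_duality.1; last exact: augmentation_ideal.
by rewrite dim_augmentation subSnn muln1.
Qed.

End Annihilators.

Section CoidealIntegral.
Variables (N : set A) (coN : left_coideal_subalgebra N).

Definition two_sided_integral (M : set A) (P : A) : Prop :=
  [/\ M P, counit P = 1 &
      forall x, M x -> x * P = counit x *: P /\ P * x = counit x *: P].

Let NN : {vspace F} := vspace_of (N : F -> Prop).

(** The left integrals of N form a line, by the duality with Y = N; let l span it.
    The duality with Y = A gives L = l a, so counit l is nonzero and l can be
    normalized to P. For x in N, P x is a left integral too, hence on that line. *)
Lemma coideal_integral (L : A) : left_integral L -> counit L = 1 ->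
  exists P, two_sided_integral N P.
Proof.
move=> intL L1.
have NN_neq0 : NN != 0%VS.
  by apply: contraTneq (NN1 coN) => NN0; rewrite -/NN NN0 memv0 oner_neq0.
have hitN f (x : F) : scalar f -> x \in NN -> (hit f x : F) \in NN.
  by move=> flin /memNN xN; apply/memNN => //; apply: coideal_hit => //; apply: xN.
have dimN := dim_annihilator_augmentation coN NN_neq0 (NNM coN) hitN.
have dim1 : \dim (orth (regular_pairing (NN1 coN) (NNM coN) (NNM coN)) (augmentation N)) = 1%N.
  apply/eqP; rewrite -(eqn_pmul2r (m := \dim NN)) ?mul1n; first exact/eqP.
  by rewrite lt0n dimv_eq0.
set Z := orth _ _ in dim1.
have ZP (y : F) : y \in Z <-> N y /\ forall x : A, N x -> x * (y : A) = counit x *: (y : A).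
  split=> [/orthP[/memNN yN augy]|[yN yint]]; last first.
    apply/orthP; split=> [|x /augmentationP[//|xN x0]]; first exact/memNN.
    by rewrite /= [x * y]yint // x0 scale0r.
  split=> [|x xN]; first exact: yN.
  apply/eqP; rewrite -subr_eq0 -[_ *: (y : A)]mulr_algl -mulrBl; apply/eqP.
  by apply: augy; exact: augmentation_sub.
have ZE (y : F) : y \in Z -> y != 0 -> Z = <[y]>%VS.
  by move=> yZ y0; apply/esym/eqP; rewrite eqEdim -memvE yZ dim1 dim_vline y0.
have [l lZ l0] : exists2 l : F, l \in Z & l != 0.
  by exists (vpick Z); [exact: memv_pick | rewrite vpick0 -dimv_eq0 dim1].
have [lN lint] := (ZP l).1 lZ.
have l1 : counit (l : A) != 0.
  have [||||a _ laL] := (coideal_duality coN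
      (Y := fullv) _ (fun x y _ _ => memvf _) (fun f y _ _ => memvf _)).2 l L.
  - by rewrite -subv0; apply: contraNN l0 => /subvP/(_ l (memvf l)); rewrite memv0.
  - exact/memNN.
  - exact: memvf.
  (* an element of N killing l has counit 0, hence kills L as well *)
  - move=> x /memNN xN xl0; have := lint x (xN coN); rewrite [_ * _]xl0 => /esym/eqP.
    by rewrite scaler_eq0 (negPf l0) orbF intL => /eqP ->; rewrite scale0r.
  by apply: contra_eq_neq L1 => le0; rewrite -laL rmorphM /= le0 mul0r eq_sym oner_neq0.
pose P : F := (counit (l : A))^-1 *: l.
have PZ : P \in Z by rewrite memvZ.
have [PN Pint] := (ZP P).1 PZ.
have P1 : counit (P : A) = 1 by rewrite linearZ /= mulVf.
exists P; split=> // x xN; split; first exact: Pint.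
have : (P * x : F) \in Z.
  by apply/ZP; split=> [|y yN]; [exact: coidealM | rewrite mulrA Pint // -scalerAl].
rewrite (ZE P) //; last by apply: contra_eq_neq P1 => ->; rewrite linear0 eq_sym oner_neq0.
case/vlineP=> k Pxk; have := congr1 (@counit K A) Pxk.
rewrite rmorphM linearZ /= P1 mul1r mulr1 => xk.
by rewrite [LHS]Pxk xk.
Qed.

End CoidealIntegral.

Definition left_fixed (P : F) : {vspace F} := vspace_of (fun y : F => P * y = y).

Lemma left_fixedP (P y : F) : y \in left_fixed P <-> P * y = y.
Proof.
apply: mem_vspace_of => [|a u v uP vP]; first exact: mulr0.
by rewrite mulrDr -scalerAr uP vP.
Qed.

(** The annihilator of N^+ = (1 - P) N in A is P A, here described as the vectors
    fixed by P; its dimension is given by the duality with Y = A. *)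
Lemma dim_coideal (N : set A) (P : A) : left_coideal_subalgebra N ->
    two_sided_integral N P ->
  (\dim (left_fixed P) * \dim (vspace_of (N : F -> Prop)) = \dim {:F})%N.
Proof.
move=> coN [PN P1 Pint].
have full_neq0 : {:F}%VS != 0%VS.
  by apply/negP => /eqP F0; have := memvf (1 : F); rewrite F0 memv0 oner_eq0.
have <- := dim_annihilator_augmentation coN full_neq0
  (fun x y _ _ => memvf _) (fun f y _ _ => memvf _).
congr (\dim _ * _)%N; apply/vspaceP => y; apply/idP/idP.
  move=> /left_fixedP Py; apply/orthP; split=> [|x /augmentationP[//|xN x0]].
    exact: memvf.
  by rewrite /= -Py mulrA [x * P](Pint x xN).1 x0 scale0r mul0r.
case/orthP=> _ augy; apply/left_fixedP; apply/esym/eqP; rewrite -subr_eq0.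
rewrite -{1}[y]mul1r -mulrBl; apply/eqP/augy/augmentationP => //; split.
  by apply: coidealB => //; exact: coideal1.
by rewrite linearB /= rmorph1 P1 subrr.
Qed.

(** By [dim_coideal] the dimension of a coideal subalgebra is determined by its
    integral. *)
Lemma coideal_eq (N N' : set A) (P : A) :
    left_coideal_subalgebra N -> left_coideal_subalgebra N' ->
    two_sided_integral N P -> two_sided_integral N' P ->
  (forall x, N x -> N' x) -> N = N'.
Proof.
move=> coN coN' intN intN' NN'.
have := dim_coideal coN' intN'; rewrite -(dim_coideal coN intN) => /eqP.
have fix_gt0 : (0 < \dim (left_fixed P))%N.
  rewrite lt0n; apply/negP => /eqP d0; have := dim_coideal coN intN.
  rewrite d0 mul0n => /esym/eqP; rewrite dimv_eq0 => /eqP F0.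
  by have := memvf (1 : F); rewrite F0 memv0 oner_eq0.
rewrite eqn_pmul2l // => /eqP dimNN'.
have /eqP eqNN' : vspace_of (N : F -> Prop) == vspace_of (N' : F -> Prop).
  rewrite eqEdim dimNN' leqnn andbT; apply/subvP => x /(memNN coN) xN.
  by apply/(memNN coN'); apply: NN'.
rewrite predeqE => x; split=> [|xN']; first exact: NN'.
by apply/(memNN coN); rewrite eqNN'; apply/(memNN coN').
Qed.

End CoidealSubalgebra.

(** * Left coideal subalgebras and group-like projections *)

Local Open Scope classical_set_scope.

Section Projections.
Variables (K : fieldType) (A : hopfAlgType K).
Implicit Types (N : set A) (P x : A).

Lemma integral_coideal_proj N P : left_coideal_subalgebra N ->
  two_sided_integral N P -> is_coideal_proj N P.
Proof.
move=> coN [PN P1 Pint]; split.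
  split=> // [|x xN]; first by rewrite /projection (Pint P PN).1 P1 scale1r.
  by rewrite (Pint x xN).1 (Pint x xN).2.
apply/seteqP; split=> [x [xN /= x0]|_ [x xN <-]].
  by exists x => //; rewrite mulrBl mul1r (Pint x xN).2 x0 scale0r subr0.
split; first by rewrite mulrBl mul1r; apply: coidealB => //; apply: coidealM.
by rewrite /= rmorphM /= linearB /= rmorph1 P1 subrr mul0r.
Qed.

(** The element x - counit(x) lies in (1 - P) N, which P kills on the left. *)
Lemma coideal_proj_mul N P x : left_coideal_subalgebra N ->
  is_coideal_proj N P -> N x -> P * x = counit x *: P.
Proof.
move=> coN [[PN PP _] kerN] xN.
have : (N `&` [set y | counit y = 0]) (x - (counit x)%:A).
  split; last by rewrite /= linearB linearZ /= rmorph1 mulr1 subrr.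
  by apply: coidealB => //; apply: coidealZ => //; exact: coideal1.
rewrite kerN => -[y _ /(congr1 ( *%R P))].
rewrite mulrA [P * (1 - P)]mulrBr mulr1 PP subrr mul0r mulrBr -scalerAr mulr1.
by move=> /esym/eqP; rewrite subr_eq0 => /eqP.
Qed.

Lemma coideal_proj_uniq N P Q : left_coideal_subalgebra N ->
  two_sided_integral N P -> is_coideal_proj N Q -> Q = P.
Proof.
move=> coN [PN P1 Pint] Qproj; have [[QN _ Qcen] kerN] := Qproj.
have Q1 : counit Q = 1.
  have : (N `&` [set y | counit y = 0]) (1 - Q).
    by rewrite kerN; exists 1; [exact: coideal1 | rewrite mulr1].
  by case=> _ /= /eqP; rewrite linearB /= rmorph1 subr_eq0 => /eqP <-.
have := coideal_proj_mul coN Qproj PN; rewrite P1 scale1r => <-.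
by rewrite (Pint Q QN).1 Q1 scale1r.
Qed.

Lemma coideal_projE N P : left_coideal_subalgebra N ->
  two_sided_integral N P -> coideal_proj N = P.
Proof.
move=> coN intP; rewrite /coideal_proj; case: xgetP => [Q _|nP].
  exact: coideal_proj_uniq.
by case: (nP P); exact: integral_coideal_proj.
Qed.

Lemma tpure_mul (a b c d : A) : (a ⊗ b) * (c ⊗ d) = (a * c) ⊗ (b * d).
Proof. exact: tmul_pure. Qed.

Lemma tensor_mul_pure1 (t : tensor A A) P :
  t * (1 ⊗ P) = tlift (fun a b => a ⊗ (b * P)) t.
Proof.
rewrite {1}[t]tensor_sumE mulr_suml; apply: eq_bigr => p _.
by rewrite tpure_mul mulr1.
Qed.

Lemma pure1_mul_tensor (t : tensor A A) P :
  (1 ⊗ P) * t = tlift (fun a b => a ⊗ (P * b)) t.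
Proof.
rewrite {1}[t]tensor_sumE mulr_sumr; apply: eq_bigr => p _.
by rewrite tpure_mul mul1r.
Qed.

Lemma tpure_bilinear_comp (f g : A -> A) : linear f -> linear g ->
  bilinear_for *:%R *:%R (fun a b => f a ⊗ g b).
Proof.
move=> flin glin; split=> [b|a] k u v /=.
  by rewrite flin; apply: (tpure_bilinear A A).1.
by rewrite glin; apply: (tpure_bilinear A A).2.
Qed.

Lemma integral_sub_proj_coideal N P : left_coideal_subalgebra N ->
  two_sided_integral N P -> forall x, N x -> proj_coideal P x.
Proof.
move=> coN [PN P1 Pint] x xN.
have plin : linear (fun a : A => a ⊗ P) := (tpure_bilinear A A).1 P.
have id_lin : linear (fun a : A => a) by [].
have eps_bil : bilinear_for *:%R *:%R (fun a b : A => counit b *: (a ⊗ P)).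
  split=> [b|a] k u v /=; first by rewrite plin scalerDr !scalerA mulrC.
  by rewrite linearP scalerDl scalerA.
split; rewrite ?tensor_mul_pure1 ?pure1_mul_tensor.
  rewrite (coideal_tlift coN (g := fun a b => counit b *: (a ⊗ P))) //.
  - exact: (comul_counitrE _ plin).
  - exact: (tpure_bilinear_comp id_lin (mulr_linear P)).
  by move=> a b bN; rewrite (Pint b bN).1 tpureZr.
rewrite (coideal_tlift coN (g := fun a b => counit b *: (a ⊗ P))) //.
- exact: (comul_counitrE _ plin).
- exact: (tpure_bilinear_comp id_lin (mull_linear P)).
by move=> a b bN; rewrite (Pint b bN).2 tpureZr.
Qed.

(** P belongs to N, so it satisfies the equations defining its own coideal. *)
Lemma integral_grouplike N P : left_coideal_subalgebra N ->
  two_sided_integral N P -> right_grouplike_projection P.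
Proof.
move=> coN intP; have [PN P1 Pint] := intP.
have [PP PP'] := integral_sub_proj_coideal coN intP PN.
split=> //; last by rewrite /projection (Pint P PN).1 P1 scale1r.
by apply: contra_eq_neq P1 => ->; rewrite linear0 eq_sym oner_neq0.
Qed.

(** Coassociativity: the functional eats the first leg and leaves the others alone. *)
Lemma comul_hit (f : A -> K) x : scalar f ->
  comul (hit f x) = tlift (fun a b => hit f a ⊗ b) (comul x).
Proof.
move=> flin.
have tri : trilinear (fun a u v : A => f a *: (u ⊗ v)).
  split=> [u v|a v|a u] k y z /=.
  - by rewrite flin scalerDl scalerA.
  - by rewrite ((tpure_bilinear A A).1 _ k) scalerDr !scalerA mulrC.
  - by rewrite ((tpure_bilinear A A).2 _ k) scalerDr !scalerA mulrC.
rewrite {1}/hit (tlift_morph _ _ (@comul_linear K A)).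
transitivity (tlift (fun a b => tlift (fun u v => f a *: (u ⊗ v)) (comul b)) (comul x)).
  apply: eq_tlift => a b; rewrite linearZ /= {1}[comul b]tensor_sumE.
  by rewrite scaler_sumr.
rewrite -(coassoc x tri); apply: eq_tlift => a b.
rewrite /hit (tlift_morph _ _ ((tpure_bilinear A A).1 b)).
by apply: eq_tlift => u v; rewrite (scalable_linear ((tpure_bilinear A A).1 b)).
Qed.

(** The defining equations concern the last leg only, so they commute with an
    operation on the first one. *)
Lemma proj_coideal_hit P (f : A -> K) x : scalar f ->
  proj_coideal P x -> proj_coideal P (hit f x).
Proof.
move=> flin [xP Px].
have hlin := hit_linear flin; have id_lin : linear (fun a : A => a) by [].
have Hb := tpure_bilinear_comp hlin id_lin.
split; rewrite comul_hit //.
  rewrite -(tlift_pure Hb x P) -xP (tensor_mul_pure1 (comul x)).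
  rewrite (tlift_morph _ _ (tlift_linear Hb)) [in LHS]/tlift /tsum mulr_suml.
  apply: eq_bigr => p _.
  by rewrite tpure_mul mulr1 (tlift_pure Hb).
rewrite -(tlift_pure Hb x P) -Px (pure1_mul_tensor (comul x)).
rewrite (tlift_morph _ _ (tlift_linear Hb)) [in LHS]/tlift /tsum mulr_sumr.
apply: eq_bigr => p _.
by rewrite tpure_mul mul1r (tlift_pure Hb).
Qed.

Lemma proj_coideal_subalgebra P n (b : 'I_n -> A) (c : 'I_n -> A -> K) :
    (forall i, scalar (c i)) -> (forall v, v = \sum_i c i v *: b i) ->
  left_coideal_subalgebra (proj_coideal P).
Proof.
move=> clin bc.
have plin : linear (fun a : A => a ⊗ P) := (tpure_bilinear A A).1 P.
split; last first.
  move=> x xP; exists [seq (b i, hit (c i) x) | i <- enum 'I_n].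
    by move=> _ /mapP[i _ ->]; apply: proj_coideal_hit.
  rewrite big_map big_enum; exact: (tensor_dual (fun v _ => bc v)).
split=> [|a x y|x y]; rewrite !inE.
- by split; rewrite rmorph1 ?mul1r ?mulr1.
- move=> [xP Px] [yP Py]; split.
    have Rb := tpure_bilinear_comp (f := id) (fun k u v => erefl) (mulr_linear P).
    by rewrite tensor_mul_pure1 comul_linear (tlift_linear Rb) -!tensor_mul_pure1 xP yP plin.
  have Lb := tpure_bilinear_comp (f := id) (fun k u v => erefl) (mull_linear P).
  by rewrite pure1_mul_tensor comul_linear (tlift_linear Lb) -!pure1_mul_tensor Px Py plin.
move=> [xP Px] [yP Py]; split; rewrite rmorphM /=.
  rewrite -mulrA yP -[y ⊗ P](_ : (1 ⊗ P) * (y ⊗ 1) = _); last by rewrite tpure_mul mul1r mulr1.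
  by rewrite mulrA xP tpure_mul mulr1.
rewrite mulrA Px -[x ⊗ P](_ : (x ⊗ 1) * (1 ⊗ P) = _); last by rewrite tpure_mul mul1r mulr1.
by rewrite -mulrA Py tpure_mul mul1r.
Qed.

(** Apply the counit to the first leg of the equations for x in the coideal; for
    x = P they give P = P P = counit(P) P. *)
Lemma grouplike_integral P : right_grouplike_projection P ->
  two_sided_integral (proj_coideal P) P.
Proof.
move=> [P0 PP PP1 PP2].
have eps_bil : bilinear_for *:%R *:%R (fun a b : A => counit a *: b) :=
  hit_bilinear (@counit_scalar K A).
have Pint x : proj_coideal P x -> x * P = counit x *: P /\ P * x = counit x *: P.
  move=> [xP Px]; split.
    have := congr1 (tlift (fun a b => counit a *: b)) xP.
    rewrite (tlift_pure eps_bil) => <-; rewrite tensor_mul_pure1.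
    rewrite (tlift_morph _ _ (tlift_linear eps_bil)).
    rewrite -(comul_counitlE x (mulr_linear P)).
    by apply: eq_tlift => a b; rewrite (tlift_pure eps_bil).
  have := congr1 (tlift (fun a b => counit a *: b)) Px.
  rewrite (tlift_pure eps_bil) => <-; rewrite pure1_mul_tensor.
  rewrite (tlift_morph _ _ (tlift_linear eps_bil)).
  rewrite -(comul_counitlE x (mull_linear P)).
  by apply: eq_tlift => a b; rewrite (tlift_pure eps_bil).
have PN : proj_coideal P P by split.
split=> //.
have [] := Pint P PN; rewrite PP => /esym/eqP.
rewrite -subr_eq0 -{3}[P]scale1r -scalerBl scaler_eq0 (negPf P0) orbF subr_eq0.
by move=> /eqP.
Qed.

End Projections.

Theorem theorem3p35 (K : fieldType) (A : hopfAlgType K)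
    (antipode_bij : bijective (@antipode K A))
    (A_semisimple : semisimple_ring A) :
  [/\ forall N : set A, left_coideal_subalgebra N ->
        exists! P : A, is_coideal_proj N P,
      set_bij (@left_coideal_subalgebras K A) (@right_grouplike_projections K A)
        (@coideal_proj K A),
      set_bij (@right_grouplike_projections K A) (@left_coideal_subalgebras K A)
        (@proj_coideal K A),
      {in @left_coideal_subalgebras K A,
        cancel (@coideal_proj K A) (@proj_coideal K A)} &
      {in @right_grouplike_projections K A,
        cancel (@proj_coideal K A) (@coideal_proj K A)}].
Proof.
have [S' SK S'K] := antipode_bij.
have [L intL L1] := semisimple_integral A_semisimple.
have [n [b [c [clin cb bc]]]] := integral_finite_dimensional intL L1.
have exP N (coN : left_coideal_subalgebra N) :=
  coideal_integral SK S'K clin cb bc coN intL L1.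
have coP P := proj_coideal_subalgebra P clin bc.
have NK : {in @left_coideal_subalgebras K A, cancel (@coideal_proj K A) (@proj_coideal K A)}.
  move=> N; rewrite inE => coN; have [P intP] := exP N coN.
  rewrite (coideal_projE coN intP); apply/esym.
  apply: (coideal_eq SK S'K clin cb bc coN (coP P) intP).
    by apply: grouplike_integral; exact: integral_grouplike intP.
  exact: integral_sub_proj_coideal intP.
have PK : {in @right_grouplike_projections K A, cancel (@proj_coideal K A) (@coideal_proj K A)}.
  move=> P; rewrite inE => gP; apply: coideal_projE (coP P) _.
  exact: grouplike_integral.
have projN (N : set A) : left_coideal_subalgebra N -> right_grouplike_projection (coideal_proj N).
  move=> coN; have [P intP] := exP N coN.
  by rewrite (coideal_projE coN intP); exact: integral_grouplike intP.
split=> //.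
- move=> N coN; have [P intP] := exP N coN; exists P; split.
    exact: integral_coideal_proj.
  by move=> Q Qproj; apply/esym; exact: coideal_proj_uniq Qproj.
- split=> [N /projN//||P gP]; first exact: can_in_inj NK.
  by exists (proj_coideal P); [exact: coP | apply: PK; rewrite inE].
split=> [P _||N coN]; [exact: coP | exact: can_in_inj PK |].
by exists (coideal_proj N); [exact: projN | apply: NK; rewrite inE].
Qed.
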